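(* Let $H$ be a subgroup of Thompson's group $F$. Then $H=F$ if and only if the following two conditions hold: (1) $H[F,F]=F$; (2) $[F,F]\le \mathrm{Cl}(H)$.
   Context: Thompson's group $F$ is the group of all increasing piecewise-linear homeomorphisms of $[0,1]$ with finitely many breakpoints, all in $\mathbb{Z}[\frac12]\cap(0,1)$, and all slopes integer powers of $2$; composition is from left to right. $[F,F]$ is its derived subgroup. Tree-diagrams. In a full finite binary tree (every vertex is a leaf or has exactly one left and one right child; a single vertex is allowed) label left edges $0$ and right edges $1$; a branch is a maximal simple path from the root, identified with its label, a finite binary word. For a finite binary word $u$, $[u]$ is the dyadic interval $[.u,\,.u1^{\mathbb N}]\subseteq[0,1]$. A tree-diagram is a pair $(T_+,T_-)$ of full finite binary trees with the same number $n$ of leaves; if their branches, ordered left to right, are $u_1,\dots,u_n$ and $v_1,\dots,v_n$, then it has the pairs of branches $u_i\to v_i$ and represents the element of $F$ mapping each $[u_i]$ linearly onto $[v_i]$. It is reduced if for no $i$ do the leaves number $i$ and $i+1$ have a common father both in $T_+$ and in $T_-$; every element of $F$ is represented by a unique reduced tree-diagram. Tree-automata. A rooted tree-automaton $\mathcal A_r$ is a directed edge-labeled graph with a distinguished root vertex $r$ such that: (1) every vertex has either zero or two outgoing edges; (2) if a vertex has two outgoing edges (it is then called a father), one is labeled $0$ and the other $1$, and their end vertices are its left and right child respectively; (3) if $x_1\ne x_2$ are fathers, then their left children are distinct or their right children are distinct; (4) every vertex is the end of a directed path starting at $r$. A finite binary word $u$ is readable on $\mathcal A_r$ if there is a (necessarily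 unique) directed path from $r$ labeled $u$; its end vertex is denoted $u^+$. A tree-diagram is accepted by $\mathcal A_r$ if all branches of both its trees are readable on $\mathcal A_r$ and $u^+=v^+$ for each of its pairs of branches $u\to v$. $\mathcal{DG}(\mathcal A_r)$ is the subgroup of $F$ of all elements whose reduced tree-diagrams are accepted by $\mathcal A_r$. Core and closure. Let $H\le F$ be generated by reduced tree-diagrams $(T^i_+,T^i_-)$, $i\in\mathcal I$. View the trees as directed labeled graphs (edges directed away from the root), identify for each $i$ each leaf of $T^i_+$ with the corresponding leaf of $T^i_-$, and identify all roots to a single vertex $r$. Then apply foldings: first, as long as possible, identify distinct edges with the same initial vertex and the same label, together with their end vertices; then, as long as possible, identify distinct vertices $x\neq y$ having two outgoing edges each and the same left child and the same right child, together with their corresponding outgoing edges (passing to the limit if infinitely many foldings are needed). The resulting rooted tree-automaton is the core $\mathcal C(H)$; it does not depend on the choices. The closure of $H$ is $\mathrm{Cl}(H)=\mathcal{DG}(\mathcal C(H))$. (It is known that $\mathrm{Cl}(H)$ is the set of all $f\in F$ that are piecewise-$H$, i.e. for which there is a finite subdivision of $[0,1]$ such that on each interval of the subdivision $f$ coincides with some element of $H$.) *)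

(* Defs.v *)
From HB Require Import structures.
From mathcomp Require Import all_boot all_order all_algebra.
From mathcomp Require Import boolp classical_sets functions reals.

Set Implicit Arguments.
Unset Strict Implicit.
Unset Printing Implicit Defensive.

Import Order.TTheory GRing.Theory Num.Theory.

Local Open Scope classical_set_scope.
Local Open Scope ring_scope.

Section ThompsonMaps.
Variable R : realType.

Definition dyadic (x : R) := exists (m : int) (n : nat), x = m%:~R / 2 ^+ n.

(* A homeomorphism of [0, 1] is represented by its extension by the identity
   to R.  An increasing bijection of [0, 1] is automatically a homeomorphism.
   The list s contains all the breakpoints of f. *)
Record thompson_map (f : R -> R) : Prop := ThompsonMap {
  thompson_off : forall x, ~~ (0 <= x <= 1) -> f x = x;
  thompson_homo : forall x y, 0 <= x -> x < y -> y <= 1 -> f x < f y;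
  thompson_bij : set_bij [set x | 0 <= x <= 1] [set x | 0 <= x <= 1] f;
  thompson_pl : exists s : seq R,
    (forall d, d \in s -> dyadic d /\ 0 < d < 1) /\
    forall a b, 0 <= a -> a < b -> b <= 1 ->
      (forall d, d \in s -> ~~ (a < d < b)) ->
      exists (k : int) (c : R), forall x, a <= x <= b -> f x = 2 ^ k * x + c
}.

Lemma dyadic_lin (k : int) (x y z : R) :
  dyadic x -> dyadic y -> dyadic z -> dyadic (x + 2 ^ k * (y - z)).
Proof.
have e2 (n : nat) : (2 ^+ n : R) != 0 by rewrite expf_neq0 // pnatr_eq0.
have dD u v : dyadic u -> dyadic v -> dyadic (u + v).
  move=> [m [n ->]] [m' [n' ->]].
  exists (m * 2 ^+ n' + m' * 2 ^+ n), (n + n')%N.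
  by rewrite rmorphD !rmorphM /= !rmorphXn /= exprD addf_div.
have dN u : dyadic u -> dyadic (- u).
  by move=> [m [n ->]]; exists (- m), n; rewrite rmorphN mulNr.
have dM u : dyadic u -> dyadic (2 ^ k * u).
  move=> [m [n ->]]; case: k => j.
    exists (2 ^+ j * m), n.
    by rewrite rmorphM rmorphXn /= mulrA.
  exists m, (j.+1 + n)%N.
  by rewrite NegzE -exprnN exprD invfM mulrCA.
by move=> dx dy dz; apply: (dD) => //; apply: dM; apply: dD => //; apply: dN.
Qed.

Section Theory.
Variable f : R -> R.
Hypothesis Ff : thompson_map f.

Lemma thompson_in x : 0 <= x <= 1 -> 0 <= f x <= 1.
Proof. by case: Ff => _ _ [fun_f _ _] _; apply: fun_f. Qed.

Lemma thompson_onto y : 0 <= y <= 1 -> exists2 x, 0 <= x <= 1 & f x = y.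
Proof. by case: Ff => _ _ [_ _ sf] _; move=> /sf [x x01 <-]; exists x. Qed.

Lemma thompson0 : f 0 = 0.
Proof.
have [|y /andP[y0 y1] fy] := @thompson_onto 0; first by rewrite lexx ler01.
case: (ltgtP 0 y) y0 => // [y0 _|yE _]; last by rewrite {1}yE.
have /andP[f0 _] : 0 <= f 0 <= 1 by apply: thompson_in; rewrite lexx ler01.
by have := thompson_homo Ff (lexx 0) y0 y1; rewrite fy ltNge f0.
Qed.

Lemma thompson1 : f 1 = 1.
Proof.
have [|y /andP[y0 y1] fy] := @thompson_onto 1; first by rewrite lexx ler01.
case: (ltgtP y 1) y1 => // [y1 _|yE _]; last by rewrite -{1}yE.
have /andP[_ f1] : 0 <= f 1 <= 1 by apply: thompson_in; rewrite lexx ler01.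
by have := thompson_homo Ff y0 y1 (lexx 1); rewrite fy ltNge f1.
Qed.

Lemma thompson_mono x y :
  0 <= x <= 1 -> 0 <= y <= 1 -> (f x < f y) = (x < y).
Proof.
move=> /andP[x0 x1] /andP[y0 y1]; case: (ltgtP x y) => [xy|yx|->].
- exact: thompson_homo.
- by apply/negbTE; rewrite -leNgt ltW //; apply: thompson_homo.
- by rewrite ltxx.
Qed.

Lemma thompson_monoe x y :
  0 <= x <= 1 -> 0 <= y <= 1 -> (f x <= f y) = (x <= y).
Proof. by move=> x01 y01; rewrite !leNgt thompson_mono. Qed.

Lemma thompson_in_open x : 0 < x < 1 -> 0 < f x < 1.
Proof.
move=> /andP[x0 x1]; have [x0' x1'] := (ltW x0, ltW x1).
have := thompson_mono (x := 0) (y := x); rewrite thompson0 => ->.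
  have := thompson_mono (x := x) (y := 1); rewrite thompson1 => ->.
    by rewrite x0.
  by rewrite x0'.
  by rewrite lexx ler01.
by rewrite lexx ler01.
by rewrite x0'.
Qed.

Lemma thompson_dyadic d : 0 <= d <= 1 -> dyadic d -> dyadic (f d).
Proof.
have [s [sd sP]] := thompson_pl Ff.
move: {2}(count (fun p => p < d) s) (leqnn (count (fun p => p < d) s)) => n.
elim: n d => [|n IHn] d len /andP[d0 d1] dd.
  case: (ltgtP 0 d) d0 => // [d0 _|<- _]; last first.
    by rewrite thompson0; exists 0, 0%N; rewrite mul0r.
  have [|k [c kc]] := sP 0 d (lexx 0) d0 d1.
    move=> p ps; move: len; rewrite leqn0 -[_ == _]negbK -lt0n -has_count.
    by move/hasPn => /(_ p ps); apply: contra => /andP[].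
  have := kc 0; rewrite thompson0 lexx ltW // mulr0 add0r => /(_ isT) c0.
  have := kc d; rewrite lexx ltW // -c0 addr0 => /(_ isT) ->.
  have -> : 2 ^ k * d = 0 + 2 ^ k * (d - 0) :> R by rewrite add0r subr0.
  by apply: dyadic_lin => //; exists 0, 0%N; rewrite mul0r.
pose t := [seq p <- s | p < d].
case: (boolP (nilp t)) => tn.
  apply: IHn; rewrite ?d0 //.
  by rewrite -size_filter -/t (nilP tn).
have [p [pt pmax]] : exists p, p \in t /\ forall q, q \in t -> q <= p.
  elim: (t) tn => // a [|b r] IH _.
    by exists a; rewrite mem_head; split=> // q; rewrite inE => /eqP ->.
  have [//|p [pr pm]] := IH.
  case: (leP a p) => ap.
    exists p; split; first by rewrite inE pr orbT.
    by move=> q; rewrite inE => /orP[/eqP -> //|/pm].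
  exists a; split; first exact: mem_head.
  move=> q; rewrite inE => /orP[/eqP -> //|/pm qp].
  exact: le_trans qp (ltW ap).
move: (pt); rewrite mem_filter => /andP[pd ps].
have [dp /andP[p0 p1]] := sd p ps.
have fp : dyadic (f p).
  apply: IHn => //; last by rewrite !ltW.
  rewrite -ltnS; apply: leq_trans len.
  have c1 : (0 < count (pred1 p) s)%N.
    by rewrite -has_count; apply/hasP; exists p => /=.
  apply: (@leq_trans (count (fun q => q < p) s + count (pred1 p) s)).
    by rewrite -addn1 leq_add2l.
  rewrite -count_predUI [count (predI _ _) s](_ : _ = 0%N) ?addn0.
    by apply: sub_count => q /= /orP[qp|/eqP -> //]; apply: lt_trans qp pd.
  apply/eqP; rewrite -leqn0 leqNgt -has_count; apply/hasPn => q _ /=.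
  by apply/negP => /andP[qp /eqP qE]; move: qp; rewrite qE ltxx.
have [|k [c kc]] := sP p d (ltW p0) pd d1.
  move=> q qs; apply/negP => /andP[pq qd].
  have := pmax q; rewrite mem_filter qd qs => /(_ isT).
  by rewrite leNgt pq.
have := kc p; rewrite lexx ltW // => /(_ isT) fpE.
have := kc d; rewrite lexx ltW // => /(_ isT) fdE.
have -> : f d = f p + 2 ^ k * (d - p).
  by rewrite fpE fdE mulrBr addrAC addrCA subrr addr0.
exact: dyadic_lin.
Qed.

End Theory.

Lemma thompson_id : thompson_map id.
Proof.
split=> //; last first.
  exists [::]; split=> // a b _ _ _ _; exists 0, 0 => x _.
  by rewrite expr0z mul1r addr0.
by split=> // x /=; exists x.
Qed.

Lemma thompson_invP (f : R -> R) : thompson_map f ->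
  exists g, [/\ thompson_map g, cancel f g & cancel g f].
Proof.
move=> Ff.
have /choice[g gP] (x : R) : exists y, f y = x /\ (0 <= y <= 1) = (0 <= x <= 1).
  case: (boolP (0 <= x <= 1)) => x01.
    by have [y y01 fy] := thompson_onto Ff x01; exists y.
  by exists x; split; [exact: thompson_off | exact/negbTE].
have fI : injective f.
  move=> x y fxy; case: (boolP (0 <= x <= 1)) (boolP (0 <= y <= 1)) => x01.
    case=> y01.
      apply/eqP; rewrite eq_le -(thompson_monoe Ff x01) //.
      by rewrite -(thompson_monoe Ff y01) // fxy lexx.
    by have := thompson_in Ff x01; rewrite fxy (thompson_off Ff y01) (negbTE y01).
  case=> y01.
    by have := thompson_in Ff y01; rewrite -fxy (thompson_off Ff x01) (negbTE x01).
  by rewrite -(thompson_off Ff x01) fxy (thompson_off Ff y01).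
have gK : cancel g f by move=> x; case: (gP x).
have fK : cancel f g by move=> x; apply: fI; rewrite gK.
have g01 x : (0 <= g x <= 1) = (0 <= x <= 1) by case: (gP x).
have gm x y : 0 <= x <= 1 -> 0 <= y <= 1 -> (g x < g y) = (x < y).
  by move=> x01 y01; rewrite -[LHS](thompson_mono Ff) ?g01 // !gK.
exists g; split=> //; split.
- by move=> x x01; rewrite -[in LHS](thompson_off Ff x01) fK.
- move=> x y x0 xy y1; rewrite gm ?x0 ?y1 ?(le_trans _ y1) ?(le_trans x0) //;
  exact: ltW.
- split.
  + by move=> x /=; rewrite g01.
  + by move=> x y _ _; apply: (can_inj gK).
  + by move=> x x01; exists (f x); [exact: (thompson_in Ff)|exact: fK].
- have [s [sd sP]] := thompson_pl Ff; exists (map f s); split.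
    move=> _ /mapP[d /sd[dd d01] ->]; split; last exact: thompson_in_open.
    by apply: thompson_dyadic => //; case/andP: d01 => *; rewrite !ltW.
  move=> a b a0 ab b1 nb.
  have a01 : 0 <= a <= 1 by rewrite a0 (le_trans (ltW ab)).
  have b01 : 0 <= b <= 1 by rewrite b1 (le_trans _ (ltW ab)).
  have [ga0 ga1] : 0 <= g a /\ g a <= 1 by apply/andP; rewrite g01.
  have [gb0 gb1] : 0 <= g b /\ g b <= 1 by apply/andP; rewrite g01.
  have [||k [c kc]] := sP (g a) (g b) ga0 _ gb1; first by rewrite gm.
    move=> d ds; have := nb (f d) (map_f f ds); apply: contra.
    have [_ /andP[/ltW d0 /ltW d1]] := sd d ds.
    rewrite -{1}(fK d) -{2}(fK d) !gm ?(thompson_in Ff) ?d0 //.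
  exists (- k), (- (2 ^ (- k) * c)) => x /andP[ax xb].
  have x01 : 0 <= x <= 1 by rewrite (le_trans a0) // (le_trans xb).
  have /kc : g a <= g x <= g b by rewrite !leNgt !gm // -!leNgt ax.
  rewrite gK => xE; rewrite {2}xE mulrDr mulrA -expfzDr ?pnatr_eq0 //.
  by rewrite addNr expr0z mul1r addrK.
Qed.

Lemma thompson_comp (f g : R -> R) :
  thompson_map f -> thompson_map g -> thompson_map (g \o f).
Proof.
move=> Ff Fg; have [f' [Ff' fK f'K]] := thompson_invP Ff.
split.
- by move=> x x01 /=; rewrite (thompson_off Ff) ?(thompson_off Fg).
- move=> x y x0 xy y1 /=.
  have x01 : 0 <= x <= 1 by rewrite x0 (le_trans (ltW xy)).
  have y01 : 0 <= y <= 1 by rewrite y1 (le_trans _ (ltW xy)).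
  by rewrite (thompson_mono Fg) ?(thompson_in Ff) ?(thompson_mono Ff).
- by apply: set_bij_comp; apply: thompson_bij.
- have [s [sd sP]] := thompson_pl Ff; have [t [td tP]] := thompson_pl Fg.
  exists (s ++ map f' t); split.
    move=> d; rewrite mem_cat => /orP[/sd //|/mapP[e /td[de e01] ->]].
    split; last exact: thompson_in_open.
    by apply: thompson_dyadic => //; case/andP: e01 => *; rewrite !ltW.
  move=> a b a0 ab b1 nb.
  have a01 : 0 <= a <= 1 by rewrite a0 (le_trans (ltW ab)).
  have b01 : 0 <= b <= 1 by rewrite b1 (le_trans _ (ltW ab)).
  have [fa0 fa1] : 0 <= f a /\ f a <= 1 by apply/andP/thompson_in.
  have [fb0 fb1] : 0 <= f b /\ f b <= 1 by apply/andP/thompson_in.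
  have [|k [c kc]] := sP a b a0 ab b1.
    by move=> d ds; apply: nb; rewrite mem_cat ds.
  have [||l [e le]] := tP (f a) (f b) fa0 _ fb1; first by rewrite thompson_mono.
    move=> d dt; have := nb (f' d); rewrite mem_cat map_f // orbT => /(_ isT).
    have [_ /andP[/ltW d0 /ltW d1]] := td d dt.
    have d01 : 0 <= f' d <= 1 by apply: thompson_in => //; rewrite d0.
    by rewrite -(thompson_mono Ff a01) // -(thompson_mono Ff _ b01) // f'K.
  exists (l + k), (2 ^ l * c + e) => x /andP[ax xb] /=.
  have x01 : 0 <= x <= 1 by rewrite (le_trans a0) // (le_trans xb).
  rewrite le ?(thompson_monoe Ff) ?ax // kc ?ax //.
  by rewrite mulrDr mulrA -expfzDr ?pnatr_eq0 // addrA.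
Qed.

End ThompsonMaps.

Record thompson (R : realType) : Type :=
  Thompson { thompson_fun :> R -> R; thompsonP : thompson_map thompson_fun }.

Section ThompsonGroup.
Variable R : realType.

HB.instance Definition _ := gen_eqMixin (thompson R).
HB.instance Definition _ := gen_choiceMixin (thompson R).

Implicit Types f g h : thompson R.

Lemma thompson_eqP f g : f =1 g -> f = g.
Proof.
case: f g => [f Ff] [g Fg] /= /funext fg; case: _ / fg in Fg *.
by congr Thompson; exact: Prop_irrelevance.
Qed.

Definition thompson_one : thompson R := Thompson (@thompson_id R).

Definition thompson_inv f : thompson R :=
  let P := cid (thompson_invP (thompsonP f)) in
  Thompson (let: And3 Fg _ _ := projT2 P in Fg).

(* Composition is from left to right: f acts first in f * g. *)
Definition thompson_mul f g : thompson R :=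
  Thompson (thompson_comp (thompsonP f) (thompsonP g)).

Lemma thompson_invK f : cancel f (thompson_inv f).
Proof. by rewrite /thompson_inv /=; case: cid => g [] /=. Qed.

Lemma thompson_invKV f : cancel (thompson_inv f) f.
Proof. by rewrite /thompson_inv /=; case: cid => g [] /=. Qed.

Fact thompson_mulA : associative thompson_mul.
Proof. by move=> f g h; apply: thompson_eqP. Qed.

Fact thompson_mul1g : left_id thompson_one thompson_mul.
Proof. by move=> f; apply: thompson_eqP. Qed.

Fact thompson_mulg1 : right_id thompson_one thompson_mul.
Proof. by move=> f; apply: thompson_eqP. Qed.

Fact thompson_mulVg : left_inverse thompson_one thompson_inv thompson_mul.
Proof. by move=> f; apply: thompson_eqP; exact: thompson_invKV. Qed.

Fact thompson_mulgV : right_inverse thompson_one thompson_inv thompson_mul.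
Proof. by move=> f; apply: thompson_eqP; exact: thompson_invK. Qed.

HB.instance Definition _ := isGroup.Build (thompson R)
  thompson_mulA thompson_mul1g thompson_mulg1 thompson_mulVg thompson_mulgV.

End ThompsonGroup.

Section Subgroups.
Variable G : groupType.
Local Open Scope group_scope.

Definition subgroup (H : set G) : Prop := group_closed (mem H).

Definition generated (A : set G) : set G := smallest subgroup A.

Definition derived : set G := generated [set [~ x, y] | x in setT & y in setT].

Definition set_mulg (A B : set G) : set G := [set x * y | x in A & y in B].

End Subgroups.

Arguments derived G : clear implicits.

(* Finite binary words; false stands for the letter 0 and true for 1. *)
Notation word := (seq bool).

Inductive tree := Leaf | Node (l r : tree).

Fixpoint branches (t : tree) : seq word :=
  if t is Node l r then map (cons false) (branches l) ++ map (cons true) (branches r)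
  else [:: [::]].

(* A vertex of a tree, internal or leaf, is identified with the label of the
   path from the root to it. *)
Fixpoint vertex_of (t : tree) (u : word) {struct u} : bool :=
  match u, t with
  | [::], _ => true
  | b :: u', Node l r => vertex_of (if b then r else l) u'
  | _ :: _, Leaf => false
  end.

Record tree_diagram := TreeDiagram {
  tree_plus : tree;
  tree_minus : tree;
  same_leaves : size (branches tree_plus) = size (branches tree_minus)
}.

Definition tree_of (D : tree_diagram) (plus : bool) : tree :=
  if plus then tree_plus D else tree_minus D.

Definition branch_pairs (D : tree_diagram) : seq (word * word) :=
  zip (branches (tree_plus D)) (branches (tree_minus D)).

Definition siblings (u v : word) : Prop :=
  exists w, u = rcons w false /\ v = rcons w true.

Definition reduced (D : tree_diagram) : Prop :=
  ~ exists i, let p := branches (tree_plus D) in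
              let m := branches (tree_minus D) in
    [/\ (i.+1 < size p)%N, siblings (nth [::] p i) (nth [::] p i.+1) &
        siblings (nth [::] m i) (nth [::] m i.+1)].

Section Represents.
Variable R : realType.

(* The dyadic fraction .u; since .u1^N = .u + 2^-|u|, the interval [u] is
   [dyadic_point u, dyadic_point u + 2^-|u|]. *)
Fixpoint dyadic_point (u : word) : R :=
  if u is b :: u' then (b%:R + dyadic_point u') / 2 else 0.

Definition in_dyadic_interval (u : word) (x : R) : Prop :=
  dyadic_point u <= x <= dyadic_point u + 2 ^- size u.

Definition represents (D : tree_diagram) (f : thompson R) : Prop :=
  forall u v, (u, v) \in branch_pairs D -> forall x, in_dyadic_interval u x ->
    f x = dyadic_point v + 2 ^+ size u / 2 ^+ size v * (x - dyadic_point u).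

End Represents.

Fixpoint walk (V : Type) (edge : V -> bool -> V -> Prop)
    (x : V) (u : word) (y : V) : Prop :=
  if u is b :: u' then exists2 z, edge x b z & walk edge z u' y else x = y.

Record tree_automaton := TreeAutomaton {
  vertex : Type;
  edge : vertex -> bool -> vertex -> Prop;
  root : vertex;
  edge_fun : forall x b y z, edge x b y -> edge x b z -> y = z;
  edge_both : forall x b y, edge x b y -> exists z, edge x (~~ b) z;
  edge_inj : forall x1 x2 y z, edge x1 false y -> edge x1 true z ->
    edge x2 false y -> edge x2 true z -> x1 = x2;
  edge_reach : forall x, exists u, walk edge root u x
}.

Section Automata.
Variable A : tree_automaton.

(* reads u x : the word u is readable on A and u^+ = x *)
Definition reads (u : word) (x : vertex A) : Prop := walk (@edge A) (root A) u x.

Definition readable (u : word) : Prop := exists x, reads u x.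

Definition accepted (D : tree_diagram) : Prop :=
  (forall plus u, u \in branches (tree_of D plus) -> readable u) /\
  (forall u v x y, (u, v) \in branch_pairs D -> reads u x -> reads v y -> x = y).

Definition DG (R : realType) : set (thompson R) :=
  [set f | exists D, [/\ reduced D, represents D f & accepted D]].

End Automata.

Arguments DG A R : clear implicits.

Section Folding.
Variables (V : Type) (edge : V -> bool -> V -> Prop) (glue : V -> V -> Prop).

(* The identifications of vertices produced from the initial identifications
   [glue] by foldings of the first kind.  Every derivation performs finitely
   many foldings; the relation itself is the limit. *)
Inductive fold1 : V -> V -> Prop :=
| Fold1Refl x : fold1 x x
| Fold1Sym x y : fold1 x y -> fold1 y x
| Fold1Trans x y z : fold1 x y -> fold1 y z -> fold1 x z
| Fold1Glue x y : glue x y -> fold1 x y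
| Fold1Edge x y b x' y' :
    fold1 x y -> edge x b x' -> edge y b y' -> fold1 x' y'.

(* The identifications after the foldings of the second kind, performed once
   those of the first kind are completed.  Merging the corresponding outgoing
   edges identifies no further vertices. *)
Inductive fold2 : V -> V -> Prop :=
| Fold2Fold1 x y : fold1 x y -> fold2 x y
| Fold2Sym x y : fold2 x y -> fold2 y x
| Fold2Trans x y z : fold2 x y -> fold2 y z -> fold2 x z
| Fold2Father x y x0 x1 y0 y1 :
    edge x false x0 -> edge x true x1 -> edge y false y0 -> edge y true y1 ->
    fold2 x0 y0 -> fold2 x1 y1 -> fold2 x y.

Hypothesis edge_both : forall x b y, edge x b y -> exists z, edge x (~~ b) z.

Let father x := exists x' b y, fold1 x x' /\ edge x' b y.

Let child x b y := exists2 x', fold1 x x' & edge x' b y.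

Lemma fold1_child x y b x' y' : fold1 x y -> child x b x' -> child y b y' ->
  fold1 x' y'.
Proof.
move=> xy [x2 xx2 e] [y2 yy2 e']; apply: Fold1Edge e e'.
by apply: Fold1Trans (Fold1Sym xx2) _; apply: Fold1Trans xy yy2.
Qed.

Lemma fold2_child_strong x y : fold2 x y ->
  ((exists b x', child x b x') <-> (exists b y', child y b y')) /\
  forall b x' y', child x b x' -> child y b y' -> fold2 x' y'.
Proof.
have fch z b z' : edge z b z' -> child z b z'.
  by exists z => //; apply: Fold1Refl.
elim=> {x y} [x y xy|x y _ [IH1 IH2]|x y z _ [IH1 IH2] _ [IH3 IH4]|
              x y x0 x1 y0 y1 ex0 ex1 ey0 ey1 f0 _ f1 _].
- split; last first.
    by move=> b x' y' cx cy; apply: Fold2Fold1; apply: fold1_child xy cx cy.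
  split=> -[b [x' [x2 xx2 e]]]; exists b, x', x2 => //.
    exact: Fold1Trans (Fold1Sym xy) xx2.
  exact: Fold1Trans xy xx2.
- split; first by split=> /IH1.
  by move=> b x' y' cx cy; apply/Fold2Sym/(IH2 b).
- split; first by split=> [/IH1/IH3|/IH3/IH1].
  move=> b x' z' cx cz.
  have [|c [y' [y2 yy2 e]]] := IH1.1; first by exists b, x'.
  have [w [y2' ew]] : exists w y3, fold1 y y3 /\ edge y3 b w.
    case: (eqVneq b c) e => [->|bc] e; first by exists y', y2.
    have [w ew] := edge_both e; exists w, y2.
    by have -> : b = ~~ c by case: b c bc {cx cz e ew} => [] [].
  case: ew => yy3 ew.
  by apply: Fold2Trans (IH2 b x' w cx _) (IH4 b w z' _ cz); exists y2'.
- split.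
    split=> _; first by exists false, y0; apply: fch.
    by exists false, x0; apply: fch.
  move=> b x' y' cx cy.
  have [xb [yb [ex ey fxy]]] :
      exists xb yb, [/\ edge x b xb, edge y b yb & fold2 xb yb].
    by case: b {cx cy}; [exists x1, y1 | exists x0, y0].
  have rx := fold1_child (Fold1Refl x) cx (fch _ _ _ ex).
  have ry := fold1_child (Fold1Refl y) (fch _ _ _ ey) cy.
  apply: Fold2Trans (Fold2Fold1 rx) _.
  exact: Fold2Trans fxy (Fold2Fold1 ry).
Qed.

Lemma fold2_child x y b x' y' :
  fold2 x y -> edge x b x' -> edge y b y' -> fold2 x' y'.
Proof.
move=> /fold2_child_strong[_ h] ex ey; apply: (h b).
  by exists x => //; apply: Fold1Refl.
by exists y => //; apply: Fold1Refl.
Qed.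

End Folding.

Section Core.
Variable S : set tree_diagram.

(* Vertices of the disjoint union of all the trees T_+ (plus = true) and T_-
   (plus = false), together with an extra vertex, which keeps the root when S
   is empty.  Only the vertices satisfying [is_vertex] are meaningful. *)
Inductive raw_vertex :=
| CommonRoot
| TreeVertex (D : tree_diagram) (plus : bool) (u : word).

Definition is_vertex (x : raw_vertex) : Prop :=
  if x is TreeVertex D plus u then S D /\ vertex_of (tree_of D plus) u
  else True.

Inductive raw_edge : raw_vertex -> bool -> raw_vertex -> Prop :=
| RawEdge D plus u b : S D -> vertex_of (tree_of D plus) (rcons u b) ->
    raw_edge (TreeVertex D plus u) b (TreeVertex D plus (rcons u b)).

Inductive raw_glue : raw_vertex -> raw_vertex -> Prop :=
| GlueRoot D plus : S D -> raw_glue CommonRoot (TreeVertex D plus [::])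
| GlueLeaf D u v : S D -> (u, v) \in branch_pairs D ->
    raw_glue (TreeVertex D true u) (TreeVertex D false v).

Definition same_vertex : raw_vertex -> raw_vertex -> Prop :=
  fold2 raw_edge raw_glue.

(* The vertices of the core are the classes of vertices of the trees. *)
Definition core_vertex : Type :=
  {C : set raw_vertex | exists2 x, is_vertex x & C = same_vertex x}.

Definition core_edge (C : core_vertex) (b : bool) (C' : core_vertex) : Prop :=
  exists x x', [/\ sval C x, sval C' x' & raw_edge x b x'].

Definition core_root : core_vertex :=
  exist _ (same_vertex CommonRoot) (ex_intro2 _ _ CommonRoot I erefl).

Lemma same_refl x : same_vertex x x.
Proof. by apply: Fold2Fold1; apply: Fold1Refl. Qed.

Lemma vertex_of_sibling t u b :
  vertex_of t (rcons u b) -> vertex_of t (rcons u (~~ b)).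
Proof. by elim: u t => [|c u IH] [|l r] //= /IH. Qed.

Lemma vertex_of_rcons t u b : vertex_of t (rcons u b) -> vertex_of t u.
Proof. by elim: u t => [|c u IH] [|l r] //= /IH. Qed.

Lemma raw_edge_both x b y : raw_edge x b y -> exists z, raw_edge x (~~ b) z.
Proof.
case=> {x b y} D plus u b SD Dub; exists (TreeVertex D plus (rcons u (~~ b))).
by constructor=> //; apply: vertex_of_sibling.
Qed.

Lemma raw_edge_vertex x b y : raw_edge x b y -> is_vertex x /\ is_vertex y.
Proof.
by case=> {x b y} D plus u b SD Dub; do 2!split=> //; apply: vertex_of_rcons Dub.
Qed.

Lemma core_vertex_eq (C C' : core_vertex) x x' :
  sval C x -> sval C' x' -> same_vertex x x' -> C = C'.
Proof.
case: C C' => [C [y vy Cy]] [C' [y' vy' Cy']] /=; rewrite {1}Cy {1}Cy'.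
move=> yx y'x' xx'; apply: eq_exist; rewrite Cy Cy'.
have yy' : same_vertex y y'.
  by apply: Fold2Trans yx _; apply: Fold2Trans xx' _; apply: Fold2Sym.
apply/seteqP; split=> z; apply: Fold2Trans => //.
exact: Fold2Sym.
Qed.

Lemma core_vertex_same (C : core_vertex) x y :
  sval C x -> sval C y -> same_vertex x y.
Proof.
case: C => [C [z vz Cz]] /=; rewrite Cz => zx zy.
exact: Fold2Trans (Fold2Sym zx) zy.
Qed.

Lemma core_vertex_ex x : is_vertex x -> exists C : core_vertex, sval C x.
Proof.
move=> vx.
have P : exists2 y, is_vertex y & same_vertex x = same_vertex y by exists x.
by exists (exist _ (same_vertex x : set raw_vertex) P); apply: same_refl.
Qed.

Lemma core_edge_fun C b C1 C2 :
  core_edge C b C1 -> core_edge C b C2 -> C1 = C2.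
Proof.
move=> [x [x' [Cx C1x' e]]] [y [y' [Cy C2y' e']]].
apply: core_vertex_eq C1x' C2y' _.
by apply: (fold2_child raw_edge_both) (core_vertex_same Cx Cy) e e'.
Qed.

Lemma core_edge_both C b C1 : core_edge C b C1 -> exists C2, core_edge C (~~ b) C2.
Proof.
move=> [x [x' [Cx _ /raw_edge_both[y e]]]].
have [C2 C2y] := core_vertex_ex (raw_edge_vertex e).2.
by exists C2, x, y.
Qed.

Lemma core_edge_inj C1 C2 C C' : core_edge C1 false C -> core_edge C1 true C' ->
  core_edge C2 false C -> core_edge C2 true C' -> C1 = C2.
Proof.
have L (B : core_vertex) : core_edge B false C -> core_edge B true C' ->
    exists x x0 x1, [/\ sval B x, sval C x0, sval C' x1,
      raw_edge x false x0 & raw_edge x true x1].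
  move=> [x [x0 [Bx Cx0 e0]]] B1; have [x1 /= e1] := raw_edge_both e0.
  exists x, x0, x1; split=> //.
  have [C2' C2x1] := core_vertex_ex (raw_edge_vertex e1).2.
  by have -> : C' = C2' by apply: core_edge_fun B1 _; exists x, x1.
move=> E0 E1 E0' E1'.
have [x [x0 [x1 [Cx Cx0 Cx1 e0 e1]]]] := L _ E0 E1.
have [y [y0 [y1 [Cy Cy0 Cy1 e0' e1']]]] := L _ E0' E1'.
apply: core_vertex_eq Cx Cy _.
by apply: Fold2Father e0 e1 e0' e1' _ _; apply: core_vertex_same; eassumption.
Qed.

Lemma walk_rcons V (edge : V -> bool -> V -> Prop) x u y b z :
  walk edge x u y -> edge y b z -> walk edge x (rcons u b) z.
Proof.
elim: u x => [|c u IH] x /=; first by move=> -> e; exists z.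
by move=> [w e wy] e'; exists w => //; apply: IH.
Qed.

Lemma core_edge_reach (C : core_vertex) : exists u, walk core_edge core_root u C.
Proof.
have [x [vx Cx]] : exists x, is_vertex x /\ sval C x.
  by case: C => C' [x vx CE]; exists x; rewrite /= CE; split=> //; apply: same_refl.
case: x vx Cx => [|D plus u] /=.
  exists [::] => /=; apply: (@core_vertex_eq core_root C CommonRoot) Cx _;
  exact: same_refl.
move=> [SD Du] Cx; exists u; elim/last_ind: u C Du Cx => [|u b IH] C Du Cx.
  apply: (@core_vertex_eq core_root C CommonRoot) Cx _; first exact: same_refl.
  by apply: Fold2Fold1; apply: Fold1Glue; constructor.
have Du' := vertex_of_rcons Du.
have [|C' C'x] := @core_vertex_ex (TreeVertex D plus u); first by [].
apply: walk_rcons (IH C' Du' C'x) _.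
by exists (TreeVertex D plus u), (TreeVertex D plus (rcons u b)).
Qed.

Definition core : tree_automaton :=
  TreeAutomaton core_edge_fun core_edge_both core_edge_inj core_edge_reach.

End Core.

(* Main.v *)
Require Import Defs.
From mathcomp Require Import all_boot all_order all_algebra.
From mathcomp Require Import boolp classical_sets functions reals.
From mathcomp Require Import ring lra zify.

Set Implicit Arguments.
Unset Strict Implicit.
Unset Printing Implicit Defensive.

Import Order.TTheory GRing.Theory Num.Theory.

Local Open Scope classical_set_scope.
Local Open Scope ring_scope.

(** Write F for Thompson's group, N for the elements of H that are the identity
near 0 and 1, and Cl(H) for the group accepted by the core.

If H = F, only F <= Cl(H) needs an argument.  The elements with an accepted
diagram, reduced or not, form a group: two diagrams are composed by hanging
trees at their leaves until the two middle trees coincide, and the branches of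
the grafted trees stay readable because those of the middle tree are
([diagrammable_subgroup]).  Reducing an accepted diagram keeps it accepted,
because two fathers with the same children are equal ([diagrammable_DG]).  The
core accepts the generators of H, hence all of H.

For the converse, every identification made in the core is witnessed by H: if
two words lead to the same vertex, then after finitely many bisections elements
of H send the pieces of one interval linearly to the corresponding pieces of the
other ([accepted_linked]).  So the elements of Cl(H) are pieced together from
finitely many elements of H, and since F = H[F,F], so are all elements of F.

Near each point, an element f of F agrees on either side with an element of H.
In fact one element of H serves for both sides ([locally_H_everywhere]).  The
germs at a point alpha of the elements of F that fix alpha form an abelian
group, the group of pairs of slopes.  Let L be the subgroup given by H.
Transported to alpha along H, the germ of f at a point x of the orbit of alpha
defines a class modulo L, trivial unless x is one of the finitely many points
where f does not agree with an element of H.  The product of these classes over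
the orbit is a homomorphism from F to an abelian group that is trivial on H, so
it is trivial on H[F,F] = F.  For h in H fixing alpha, apply this to the map f
equal to the identity before alpha and to h after it.  Only alpha contributes to
the product, so f agrees near alpha with an element of H.

Next, elements of H of arbitrarily small support move any given point
([H_small_moves]).  Suppose that for some x the elements of H that are the
identity on [0, x] and near 1 have common fixed points s > x, and let tau(x) be
their supremum.  It is less than 1 because H, mapping onto the abelianization of
F, contains an element that is the identity near 0 and pushes points near 1
towards 1.  The map tau is nondecreasing and commutes with H, so its image is
dense, and an element of H that is the identity on [0, x] is then the identity
up to tau(x) > x.  This is absurd: an element of N has a least moved point, and
conjugation by H brings that point into [x, s), where tau is defined too
([not_stuck]).

Finally N is normal in F ([H_compact_supp_normal]): on small supports,
conjugation by f is conjugation by an element of H, and elements of small support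
suffice to shrink any support.  Higman's commutator argument then puts in N all
commutators of elements of F that are the identity near 0 and 1, and such
elements are central modulo N because any element of F agrees with one of them on
a compact subset of (0, 1).  As F = H[F,F], all commutators of F are in N, so
[F,F] <= N <= H and H = H[F,F] = F. *)

(** * Groups, and Thompson maps as order automorphisms of the line *)

Section Subgroups.
Variables (G : groupType) (H : set G).
Hypothesis sH : subgroup H.

Lemma subgroup1 : H 1%g.
Proof. by case: sH; rewrite in_setE. Qed.

Lemma subgroupV x : H x -> H x^-1%g.
Proof. by move=> /mem_set Hx; apply: set_mem; apply: (group_closedV sH). Qed.

Lemma subgroupM x y : H x -> H y -> H (x * y)%g.
Proof.
by move=> /mem_set Hx /mem_set Hy; apply: set_mem; apply: (group_closedM sH).
Qed.

Lemma subgroupJ x y : H x -> H y -> H (x ^ y)%g.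
Proof. by move=> Hx Hy; do 2?apply: subgroupM => //; apply: subgroupV. Qed.

Lemma subgroupR x y : H x -> H y -> H [~ x, y]%g.
Proof. by move=> Hx Hy; apply: subgroupM; [apply: subgroupV|apply: subgroupJ]. Qed.

End Subgroups.

Lemma subgroupP (G : groupType) (H : set G) : H 1%g ->
  (forall x y, H x -> H y -> H (x * y)%g) -> (forall x, H x -> H x^-1%g) ->
  subgroup H.
Proof.
move=> H1 HM HV; split; first by rewrite in_setE.
by move=> x y; rewrite !in_setE => Hx Hy; apply: HM => //; apply: HV.
Qed.

Lemma commMgJ (G : groupType) (x y z : G) :
  [~ x * y, z]%g = ([~ x, z] ^ y * [~ y, z])%g.
Proof. by rewrite /commg /conjg !gnorm. Qed.

Lemma commgMJ (G : groupType) (x y z : G) :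
  [~ x, y * z]%g = ([~ x, z] * [~ x, y] ^ z)%g.
Proof. by rewrite /commg /conjg !gnorm. Qed.

Section Automorphisms.
Variable R : realType.
Implicit Types (f g h : thompson R) (x y : R).

Lemma tmulE f g x : (f * g)%g x = g (f x).
Proof. by []. Qed.

Lemma toneE x : (1%g : thompson R) x = x.
Proof. by []. Qed.

Lemma tinvK f : cancel f (f^-1)%g.
Proof. exact: thompson_invK. Qed.

Lemma tinvKV f : cancel (f^-1)%g f.
Proof. exact: thompson_invKV. Qed.

Lemma tconjE f g x : (f ^ g)%g x = g (f ((g^-1)%g x)).
Proof. by []. Qed.

Lemma tfixV f x : f x = x -> (f^-1)%g x = x.
Proof. by move=> fx; rewrite -{1}fx tinvK. Qed.

Lemma thompson_out f x : x <= 0 \/ 1 <= x -> f x = x.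
Proof.
have Ff := thompsonP f; case=> hx.
  case: (ltgtP x 0) hx => // [x0 _|-> _]; last exact: thompson0.
  by apply: (thompson_off Ff); rewrite negb_and -ltNge x0.
case: (ltgtP x 1) hx => // [x1 _|-> _]; last exact: thompson1.
by apply: (thompson_off Ff); rewrite negb_and -!ltNge x1 orbT.
Qed.

Lemma thompson_le f : {mono f : x y / x <= y}.
Proof.
apply: le_mono => x y xy; have Ff := thompsonP f.
have in01 z : 0 < z < 1 -> 0 < f z < 1 by apply: thompson_in_open.
have [x0|x0] := leP x 0.
  rewrite (thompson_out _ (or_introl x0)).
  have [y0|y0] := leP y 0; first by rewrite (thompson_out _ (or_introl y0)).
  have [y1|y1] := leP 1 y; first by rewrite (thompson_out _ (or_intror y1)).
  by have := in01 y; rewrite y0 y1 => /(_ isT) /andP[fy0 _]; apply: le_lt_trans fy0.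
have [x1|x1] := leP 1 x.
  have y1 : 1 <= y by apply: le_trans (ltW xy).
  by rewrite (thompson_out _ (or_intror x1)) (thompson_out _ (or_intror y1)).
have [y1|y1] := leP 1 y.
  rewrite (thompson_out _ (or_intror y1)).
  by have := in01 x; rewrite x0 x1 => /(_ isT) /andP[_ fx1]; apply: lt_le_trans y1.
by apply: (thompson_homo Ff); [apply: ltW | | apply: ltW].
Qed.

Lemma thompson_lt f : {mono f : x y / x < y}.
Proof. exact/leW_mono/thompson_le. Qed.

Lemma tinj f : injective f.
Proof. exact: can_inj (tinvK f). Qed.

Lemma thompson01 f x : (0 < f x < 1) = (0 < x < 1).
Proof.
rewrite -{1}(thompson0 (thompsonP f)) -{1}(thompson1 (thompsonP f)).
by rewrite !thompson_lt.
Qed.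

Lemma tltV f x y : (f x < y) = (x < (f^-1)%g y).
Proof. by rewrite -(thompson_lt f x) tinvKV. Qed.

Lemma tgtV f x y : (y < f x) = ((f^-1)%g y < x).
Proof. by rewrite -(thompson_lt f _ x) tinvKV. Qed.

Lemma tleV f x y : (f x <= y) = (x <= (f^-1)%g y).
Proof. by rewrite -(thompson_le f x) tinvKV. Qed.

Lemma tgeV f x y : (y <= f x) = ((f^-1)%g y <= x).
Proof. by rewrite -(thompson_le f _ x) tinvKV. Qed.

End Automorphisms.

(** * Piecewise linear maps with dyadic breakpoints *)

Section Dyadic.
Variable R : realType.
Implicit Types (x y : R) (u v w : word).

Lemma dyadic0 : dyadic (0 : R).
Proof. by exists 0, 0%N; rewrite mul0r. Qed.

Lemma dyadic1 : dyadic (1 : R).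
Proof. by exists 1, 0%N; rewrite expr0 divr1. Qed.

Lemma dyadicD x y : dyadic x -> dyadic y -> dyadic (x + y).
Proof.
by move=> dx /(dyadic_lin 0 dx)/(_ dyadic0); rewrite expr0z mul1r subr0.
Qed.

Lemma dyadicM2 k x : dyadic x -> dyadic (2 ^ k * x).
Proof.
by move=> dx; have := dyadic_lin k dyadic0 dx dyadic0; rewrite add0r subr0.
Qed.

Lemma dyadic_exp n : dyadic (2 ^- n : R).
Proof. by exists 1, n; rewrite mul1r. Qed.

Lemma exp2_gt0 n : 0 < (2 ^- n : R).
Proof. by rewrite invr_gt0 exprn_gt0. Qed.

Lemma dyadic_point_cat u v :
  dyadic_point R (u ++ v) = dyadic_point R u + 2 ^- size u * dyadic_point R v.
Proof.
elim: u => [|b u IH] /=; first by rewrite expr0 invr1 mul1r add0r.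
by rewrite IH exprS invfM; ring.
Qed.

Lemma dyadic_point_rcons u b :
  dyadic_point R (rcons u b) = dyadic_point R u + b%:R * 2 ^- (size u).+1.
Proof. by rewrite -cats1 dyadic_point_cat /= exprS invfM; ring. Qed.

Lemma dyadic_point_dyadic u : dyadic (dyadic_point R u).
Proof.
elim: u => [|b u IH]; first exact: dyadic0.
have -> : dyadic_point R (b :: u) = 2 ^ (-1) * (b%:R + dyadic_point R u).
  by rewrite /= exprN1 mulrC.
by apply/dyadicM2/dyadicD => //; case: b; [exact: dyadic1 | exact: dyadic0].
Qed.

Lemma dyadic_interval01 u :
  0 <= dyadic_point R u /\ dyadic_point R u + 2 ^- size u <= 1.
Proof.
elim: u => [|b u [IH0 IH1]] /=; first by rewrite expr0 invr1 add0r.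
by rewrite exprS invfM; case: b => /=; split; lra.
Qed.

End Dyadic.

Section PLMaps.
Variable R : realType.
Implicit Types (f g : R -> R) (a b c d m n p x y z : R).

(** The restriction to [a, b] of an element of F, up to dyadic translations.  The
case a = b is allowed, so that gluing needs no case distinction when a piece at
an end of [0, 1] is empty. *)
Record plmap a b c d f : Prop := PLMap {
  pl_lt : forall x y, a <= x -> x < y -> y <= b -> f x < f y;
  pl_start : f a = c;
  pl_end : f b = d;
  pl_onto : forall y, c <= y <= d -> exists2 x, a <= x <= b & f x = y;
  pl_pieces : exists s : seq R,
    (forall p, p \in s -> dyadic p /\ a < p < b) /\
    forall x y, a <= x -> x < y -> y <= b ->
      (forall p, p \in s -> ~~ (x < p < y)) ->
      exists (k : int) (c' : R), forall z, x <= z <= y -> f z = 2 ^ k * z + c'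
}.

Lemma plmap_linear (k : int) a b c d : a <= b -> d - c = 2 ^ k * (b - a) ->
  plmap a b c d (fun x => c + 2 ^ k * (x - a)).
Proof.
move=> ab dc; have k0 : (2 : R) ^ k > 0 by rewrite exprz_gt0.
split.
- by move=> x y _ xy _; rewrite ltrD2l ltr_pM2l // ltrD2r.
- by rewrite subrr mulr0 addr0.
- by rewrite -dc addrC subrK.
- move=> y /andP[cy yd]; exists (a + (y - c) / 2 ^ k); last first.
    by rewrite [a + _]addrC addrK mulrC divfK ?gt_eqF // addrC subrK.
  rewrite lerDl divr_ge0 ?subr_ge0 ?(ltW k0) //= -lerBrDl ler_pdivrMr //.
  by rewrite mulrC -dc lerD2r.
- exists [::]; split=> // x y _ _ _ _; exists k, (c - 2 ^ k * a) => z _.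
  by rewrite mulrBr; ring.
Qed.

Lemma plmap_cat m a b c d n f g : dyadic m -> a <= m -> m <= b ->
  plmap a m c n f -> plmap m b n d g ->
  plmap a b c d (fun x => if x <= m then f x else g x).
Proof.
move=> dm am mb [flt fs fe fo [s [sd sP]]] [glt gs ge go [t [td tP]]].
have gE x : m <= x -> (if x <= m then f x else g x) = g x.
  by case: ltgtP => // <- _; rewrite fe gs.
have fle x : a <= x -> x <= m -> f x <= n.
  by move=> ax; rewrite -fe; case: ltgtP => // [xm _|-> //]; apply/ltW/flt.
have gge x : m <= x -> x <= b -> n <= g x.
  by rewrite -gs; case: ltgtP => // [mx _ xb|-> //]; apply/ltW/glt.
split.
- move=> x y ax xy yb; case: (leP y m) => ym.
    by rewrite (le_trans (ltW xy) ym); apply: flt.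
  case: (leP x m) => xm; last by apply: glt => //; apply: ltW.
  apply: (le_lt_trans (fle x ax xm)); rewrite -gs.
  by apply: glt.
- by rewrite am.
- by rewrite gE.
- move=> y /andP[cy yd]; case: (leP y n) => yn.
    have [|x /andP[ax xm] <-] := fo y; first by rewrite cy.
    by exists x; rewrite ?ax ?(le_trans xm) // xm.
  have [|x /andP[mx xb] <-] := go y; first by rewrite ltW.
  by exists x; rewrite ?(le_trans am) // gE.
- exists [seq p <- s ++ m :: t | a < p < b]; split.
    move=> p; rewrite mem_filter => /andP[-> ]; rewrite mem_cat inE.
    by case/or3P => [/sd[]|/eqP ->|/td[]].
  move=> x y ax xy yb nb.
  have nb' p : p \in s ++ m :: t -> ~~ (x < p < y).
    move=> ps; apply/negP => /andP[xp py]; have := nb p.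
    rewrite mem_filter ps xp py (le_lt_trans ax xp) (lt_le_trans py yb).
    by move=> /(_ isT).
  have := nb' m; rewrite mem_cat inE eqxx orbT => /(_ isT).
  rewrite negb_and -!leNgt => /orP[mx|ym].
    have [|k [e ke]] := tP x y mx xy yb.
      by move=> p pt; apply: nb'; rewrite mem_cat inE pt !orbT.
    exists k, e => z /[dup] /andP[xz _] /ke <-; apply: gE.
    exact: le_trans xz.
  have [|k [e ke]] := sP x y ax xy ym.
    by move=> p ps; apply: nb'; rewrite mem_cat ps.
  by exists k, e => z /[dup] /andP[_ zy] /ke <-; rewrite (le_trans zy).
Qed.

Lemma thompson_plmap (f : thompson R) a b :
  0 <= a -> a <= b -> b <= 1 -> plmap a b (f a) (f b) f.
Proof.
move=> a0 ab b1; split=> //.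
- by move=> x y _ xy _; rewrite thompson_lt.
- move=> y /andP[ay yb]; exists ((f^-1)%g y); last by rewrite tinvKV.
  by rewrite -(thompson_le f) -[X in _ && X](thompson_le f) tinvKV ay.
- have [s [sd sP]] := thompson_pl (thompsonP f).
  exists [seq p <- s | a < p < b]; split.
    by move=> p; rewrite mem_filter => /andP[-> /sd[]].
  move=> x y ax xy yb nb; apply: sP; rewrite ?(le_trans a0) ?(le_trans yb) //.
  move=> p ps; apply/negP => /andP[xp py].
  have := nb p; rewrite mem_filter ps xp py.
  by rewrite (le_lt_trans ax xp) (lt_le_trans py yb) => /(_ isT).
Qed.

Lemma plmap_thompson f : plmap 0 1 0 1 f ->
  exists g : thompson R, forall x, 0 <= x <= 1 -> g x = f x.
Proof.
move=> [flt fs fe fo [s [sd sP]]].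
pose g x := if 0 <= x <= 1 then f x else x.
have gE x : 0 <= x <= 1 -> g x = f x by rewrite /g => ->.
have f01 x : 0 <= x -> x <= 1 -> 0 <= f x <= 1.
  move=> x0 x1; rewrite -{1}fs -fe.
  case: (ltgtP 0 x) x0 => // [x0 _|<- _]; last by rewrite lexx ltW ?flt.
  rewrite ltW ?flt //=.
  by case: (ltgtP x 1) x1 => // [x1 _|-> _]; rewrite ?lexx // ltW ?flt // ltW.
suff Fg : thompson_map g by exists (Thompson Fg) => x /gE.
split.
- by move=> x; rewrite /g => /negbTE ->.
- move=> x y x0 xy y1; rewrite !gE; first exact: flt.
    by rewrite y1 (le_trans x0) // ltW.
  by rewrite x0 (le_trans _ y1) // ltW.
- split.
  + by move=> x /= x01; rewrite gE //; case/andP: x01; apply: f01.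
  + move=> x y; rewrite !in_setE /= => x01 y01; rewrite !gE // => fxy.
    move: x01 y01 => /andP[x0 x1] /andP[y0 y1].
    case: (ltgtP x y) => // h.
      by have := flt x y x0 h y1; rewrite fxy ltxx.
    by have := flt y x y0 h x1; rewrite fxy ltxx.
  + by move=> y /fo[x x01 <-]; exists x => //; apply: gE.
- exists s; split=> // a b a0 ab b1 nb.
  have [k [c kc]] := sP a b a0 ab b1 nb; exists k, c => x /[dup] /kc <-.
  by move=> /andP[ax xb]; apply: gE; rewrite (le_trans a0) // (le_trans xb).
Qed.

Lemma thompson_glue (f g : thompson R) p : dyadic p -> 0 <= p <= 1 ->
  f p = g p -> exists h : thompson R,
    (forall x, x <= p -> h x = f x) /\ (forall x, p <= x -> h x = g x).
Proof.
move=> dp /andP[p0 p1] fgp.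
have pf := thompson_plmap f (lexx 0) p0 p1.
have pg := thompson_plmap g p0 p1 (lexx 1).
rewrite -fgp in pg; have := plmap_cat dp p0 p1 pf pg.
rewrite (thompson_out _ (or_introl _)) // (thompson_out _ (or_intror _)) //.
move=> /plmap_thompson[h hE]; exists h.
have hE' x : h x = if x <= p then f x else g x.
  case: (leP 0 x) => x0; last first.
    have out k : (k : thompson R) x = x by apply: thompson_out; left; apply: ltW.
    by rewrite !out if_same.
  case: (leP x 1) => x1; first by rewrite hE ?x0.
  have out k : (k : thompson R) x = x by apply: thompson_out; right; apply: ltW.
  by rewrite !out if_same.
split=> x xp; rewrite hE'; first by rewrite xp.
case: (leP x p) => // xp'; have -> : x = p by lra.
exact: fgp.
Qed.

End PLMaps.

Section Bump.
Variable R : realType.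

(** The standard generator of F, shrunk to [a, a + 4d]: slopes 1/2, 1 and 2 on
[a, a + 2d], [a + 2d, a + 3d] and [a + 3d, a + 4d].  Everything below that needs
a particular element of F is built from these. *)
Lemma thompson_bump (a d : R) :
  dyadic a -> dyadic d -> 0 < d -> 0 <= a -> a + 4 * d <= 1 ->
  exists f : thompson R,
    [/\ forall x, x <= a \/ a + 4 * d <= x -> f x = x,
        forall x, a < x < a + 4 * d -> f x < x,
        forall x, a <= x <= a + 2 * d -> f x = a + 2^-1 * (x - a) &
        forall x, a + 3 * d <= x <= a + 4 * d ->
          f x = a + 4 * d + 2 * (x - (a + 4 * d))].
Proof.
move=> da dd d0 a0 ad1.
have d2 : dyadic (2 * d) by have := dyadicM2 1 dd; rewrite expr1z.
have d4 : dyadic (4 * d).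
  by rewrite (_ : 4 * d = 2 * d + 2 * d); [apply: dyadicD | ring].
have d3 : dyadic (3 * d).
  by rewrite (_ : 3 * d = 2 * d + d); [apply: dyadicD | ring].
have p1 : plmap a (a + 2 * d) a (a + d) (fun x => a + 2 ^ (-1) * (x - a)).
  by apply: plmap_linear; rewrite ?exprN1; lra.
have p2 : plmap (a + 2 * d) (a + 3 * d) (a + d) (a + 2 * d)
    (fun x => a + d + 2 ^ 0 * (x - (a + 2 * d))).
  by apply: plmap_linear; rewrite ?expr0z; lra.
have p3 : plmap (a + 3 * d) (a + 4 * d) (a + 2 * d) (a + 4 * d)
    (fun x => a + 2 * d + 2 ^ 1 * (x - (a + 3 * d))).
  by apply: plmap_linear; rewrite ?expr1z; lra.
have p0 : plmap 0 a 0 a (fun x : R => 0 + 2 ^ 0 * (x - 0)).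
  by apply: plmap_linear; rewrite ?expr0z; lra.
have p4 : plmap (a + 4 * d) 1 (a + 4 * d) 1
    (fun x : R => a + 4 * d + 2 ^ 0 * (x - (a + 4 * d))).
  by apply: plmap_linear; rewrite ?expr0z; lra.
have i1 : a <= a + 2 * d by lra.
have i2 : a + 2 * d <= a + 3 * d by lra.
have i3 : a + 3 * d <= a + 4 * d by lra.
have p34 := plmap_cat (dyadicD da d4) i3 ad1 p3 p4.
have p24 := plmap_cat (dyadicD da d3) i2 (le_trans i3 ad1) p2 p34.
have p14 := plmap_cat (dyadicD da d2) i1 (le_trans i2 (le_trans i3 ad1)) p1 p24.
have a1 : a <= 1 by lra.
have [f fE] := plmap_thompson (plmap_cat da a0 a1 p0 p14).
exists f; rewrite !exprN1 !expr0z !expr1z in fE.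
have fE' x : a <= x <= a + 4 * d -> x <= a \/ f x = if x <= a + 2 * d then
    a + 2^-1 * (x - a) else if x <= a + 3 * d then a + d + 1 * (x - (a + 2 * d))
    else a + 2 * d + 2 * (x - (a + 3 * d)).
  move=> /andP[ax xd]; case: (leP x a) => xa; [by left | right].
  rewrite fE; last by apply/andP; split; lra.
  by rewrite leNgt xa /= xd.
have fa : f a = a by rewrite fE ?lexx; [lra | apply/andP; split; lra].
split.
- move=> x; case: (leP x 0) => x0; first by rewrite (thompson_out _ (or_introl x0)).
  case: (leP 1 x) => x1; first by rewrite (thompson_out _ (or_intror x1)).
  rewrite fE; last by rewrite !ltW.
  by case=> ?; do 4?[case: leP => ?]; lra.
- move=> x /andP[ax xd]; case: (fE' x); rewrite ?(ltW ax) ?(ltW xd) //; first by move=> ?; lra.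
  move=> ->; case: (leP x (a + 2 * d)) => ?; first lra.
  by case: (leP x (a + 3 * d)) => ?; lra.
- move=> x /andP[ax xd]; case: (fE' x); first by apply/andP; split; lra.
    move=> xa; have -> : x = a by lra.
    by rewrite fa; lra.
  by rewrite xd.
- move=> x /andP[ax xd]; case: (fE' x); [by apply/andP; split; lra|by move=> ?; lra|].
  by move=> ->; do 2?[case: leP => ?]; lra.
Qed.

End Bump.

(** * Tree-diagrams represent elements of F *)

Section Realization.
Variable R : realType.
Implicit Types (u v w : word) (us vs : seq word) (a b c d x y : R).

Fixpoint chain a us b : Prop :=
  if us is u :: us' then dyadic_point R u = a /\ chain (a + 2 ^- size u) us' b
  else a = b.

Definition linear_on (f : R -> R) u v : Prop :=
  forall x, in_dyadic_interval u x ->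
    f x = dyadic_point R v + 2 ^+ size u / 2 ^+ size v * (x - dyadic_point R u).

Lemma chain_cat a us vs m b : chain a us m -> chain m vs b -> chain a (us ++ vs) b.
Proof.
by elim: us a => [|u us IH] a /=; [move=> -> | case=> -> /IH h /h].
Qed.

Lemma chain_branches t w : chain (dyadic_point R w)
  (map (cat w) (branches t)) (dyadic_point R w + 2 ^- size w).
Proof.
elim: t w => [|l IHl r IHr] w /=; first by rewrite cats0.
rewrite map_cat -!map_comp; apply: chain_cat.
  have := IHl (rcons w false); rewrite size_rcons dyadic_point_rcons mul0r addr0.
  set s := map _ _; set s' := map _ _ => h; have -> : s' = s; last exact: h.
  by apply: eq_map => u /=; rewrite -cats1 -catA.
have := IHr (rcons w true); rewrite size_rcons dyadic_point_rcons mul1r.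
have -> : dyadic_point R w + 2 ^- (size w).+1 + 2 ^- (size w).+1 =
  dyadic_point R w + 2 ^- size w by rewrite exprS invfM; lra.
set s := map _ _; set s' := map _ _ => h; have -> : s' = s; last exact: h.
by apply: eq_map => u /=; rewrite -cats1 -catA.
Qed.

Lemma chain_le a us b : chain a us b -> a <= b.
Proof.
elim: us a => [|u us IH] a /=; first by move=> ->.
by case=> _ /IH; apply: le_trans; rewrite lerDl ltW // exp2_gt0.
Qed.

Lemma chain_mem a us b u : chain a us b -> u \in us ->
  a <= dyadic_point R u.
Proof.
elim: us a => [|u' us IH] a //= [<- ch]; rewrite inE => /orP[/eqP -> //|us_u].
by apply: le_trans (IH _ ch us_u); rewrite lerDl ltW // exp2_gt0.
Qed.

(** Two chains with the same number of intervals are matched interval by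
interval; each slope is a power of 2 because both lengths are. *)
Lemma chain_plmap us vs a b c d : size us = size vs -> dyadic a ->
  chain a us b -> chain c vs d ->
  exists2 f, plmap a b c d f & forall u v, (u, v) \in zip us vs -> linear_on f u v.
Proof.
elim: us vs a c => [|u us IH] [|v vs] a c //=.
  move=> _ _ -> ->; exists (fun x => d + 2 ^ 0 * (x - b)) => //.
  by apply: plmap_linear; rewrite // !subrr mulr0.
move=> [sz] da [ua chu] [vc chv].
have du : dyadic (a + 2 ^- size u : R) by apply/dyadicD/dyadic_exp.
have [f pf fP] := IH vs _ _ sz du chu chv.
have slope : 2 ^+ size u / 2 ^+ size v = 2 ^ ((size u)%:Z - (size v)%:Z) :> R.
  by rewrite expfzDr ?pnatr_eq0 // -exprz_inv -exprVn.
have am : a <= a + 2 ^- size u by rewrite lerDl ltW // exp2_gt0.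
have p1 : plmap a (a + 2 ^- size u) c (c + 2 ^- size v)
    (fun x => c + 2 ^ ((size u)%:Z - (size v)%:Z) * (x - a)).
  apply: plmap_linear => //; rewrite -slope ![_ + 2 ^- _]addrC !addrK.
  by rewrite mulrAC divff ?mul1r // expf_neq0 // pnatr_eq0.
eexists; first exact: plmap_cat du am (chain_le chu) p1 pf.
move=> u' v'; rewrite inE => /orP[/eqP[-> ->]|uv] x /=.
  by rewrite /in_dyadic_interval ua vc => /andP[_ ->]; rewrite slope.
move=> xu; rewrite -(fP _ _ uv x xu).
have mx : a + 2 ^- size u <= x.
  case/andP: xu => ux _; apply: le_trans ux; apply: chain_mem chu _.
  by have := map_f fst uv; rewrite -/(unzip1 _) unzip1_zip // sz.
case: ltgtP mx => // <- _.
by rewrite (pl_start pf) (pl_end p1).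
Qed.

Lemma diagram_represented D : exists f : thompson R, represents D f.
Proof.
have [f pf fP] : exists2 f, plmap (0 : R) 1 0 1 f &
    forall u v, (u, v) \in branch_pairs D -> linear_on f u v.
  apply: chain_plmap (same_leaves D) (dyadic0 R) _ _.
    by have := chain_branches (tree_plus D) [::]; rewrite /= expr0 invr1 add0r map_id.
  by have := chain_branches (tree_minus D) [::]; rewrite /= expr0 invr1 add0r map_id.
have [g gE] := plmap_thompson pf; exists g => u v uv x xu.
rewrite gE; first exact: fP.
have [u0 u1] := dyadic_interval01 R u; case/andP: xu => ux xu.
by rewrite (le_trans u0) // (le_trans xu).
Qed.

End Realization.

(** * Elements accepted by the core are piecewise in H *)

Section LinearOn.
Variable R : realType.
Implicit Types (f g h : thompson R) (u v w : word) (x y : R).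

Lemma in_dyadic_interval_rcons u b x :
  in_dyadic_interval (rcons u b) x -> in_dyadic_interval u x.
Proof.
rewrite /in_dyadic_interval dyadic_point_rcons size_rcons exprS invfM.
by have := exp2_gt0 R (size u); case: b => /= ? /andP[? ?]; apply/andP; split; lra.
Qed.

Lemma linear_on_rcons f u v b :
  linear_on f u v -> linear_on f (rcons u b) (rcons v b).
Proof.
move=> fuv x xu; rewrite fuv; last exact: in_dyadic_interval_rcons xu.
rewrite !dyadic_point_rcons !size_rcons !exprS.
by field; rewrite !expf_neq0 // pnatr_eq0.
Qed.

Lemma linear_on_id u : linear_on (1%g : thompson R) u u.
Proof. by move=> x _; rewrite divff ?expf_neq0 ?pnatr_eq0 // mul1r toneE addrC subrK. Qed.

Lemma linear_on_in f u v x : linear_on f u v ->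
  in_dyadic_interval u x -> in_dyadic_interval v (f x).
Proof.
move=> fuv xu; have := xu; rewrite fuv // /in_dyadic_interval => /andP[ux xu'].
have u0 := exp2_gt0 R (size u); have v0 := exp2_gt0 R (size v).
have s0 : 0 <= 2 ^+ size u / 2 ^+ size v :> R by rewrite divr_ge0 // exprn_ge0.
rewrite lerDl mulr_ge0 ?subr_ge0 //= lerD2l.
have E : 2 ^- size v = 2 ^+ size u / 2 ^+ size v * 2 ^- size u :> R.
  by field; rewrite !expf_neq0 // pnatr_eq0.
by rewrite [leRHS]E ler_wpM2l // lerBlDl.
Qed.

Lemma linear_on_mul f g u v w :
  linear_on f u v -> linear_on g v w -> linear_on (f * g)%g u w.
Proof.
move=> fuv gvw x xu; rewrite tmulE gvw; last exact: linear_on_in xu.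
by rewrite fuv //; field; rewrite !expf_neq0 // pnatr_eq0.
Qed.

Lemma linear_on_inv f u v : linear_on f u v -> linear_on (f^-1)%g v u.
Proof.
move=> fuv x xv.
set y := dyadic_point R u + 2 ^+ size v / 2 ^+ size u * (x - dyadic_point R v).
suff [yu fy] : in_dyadic_interval u y /\ f y = x by rewrite -fy tinvK.
have v0 := exp2_gt0 R (size v).
have s0 : 0 <= 2 ^+ size v / 2 ^+ size u :> R by rewrite divr_ge0 // exprn_ge0.
have yu : in_dyadic_interval u y.
  case/andP: xv => vx xv; rewrite /in_dyadic_interval /y.
  rewrite lerDl mulr_ge0 ?subr_ge0 //= lerD2l.
  have E : 2 ^- size u = 2 ^+ size v / 2 ^+ size u * 2 ^- size v :> R.
    by field; rewrite !expf_neq0 // pnatr_eq0.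
  by rewrite [leRHS]E ler_wpM2l // lerBlDl.
by split=> //; rewrite fuv // /y; field; rewrite !expf_neq0 // pnatr_eq0.
Qed.

End LinearOn.

Section CorePieces.
Variables (R : realType) (H : set (thompson R)).
Hypothesis sH : subgroup H.
Implicit Types (f g h : thompson R) (u v w : word) (x y : R).

(** A bisection tree is not recorded, and H may use a different element on each
piece: this is what makes the relation transitive and stable under the merging of
fathers with the same children. *)
Inductive locally_linked : word -> word -> Prop :=
| LinkedBy h u v : H h -> linear_on h u v -> locally_linked u v
| LinkedSplit u v : locally_linked (rcons u false) (rcons v false) ->
    locally_linked (rcons u true) (rcons v true) -> locally_linked u v.

Lemma linked_refl u : locally_linked u u.
Proof. by apply: (LinkedBy (subgroup1 sH)); apply: linear_on_id. Qed.

Lemma linked_sym u v : locally_linked u v -> locally_linked v u.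
Proof.
elim=> {u v} [h u v Hh huv|u v _ h0 _ h1]; last exact: LinkedSplit.
exact: (LinkedBy (subgroupV sH Hh)) (linear_on_inv huv).
Qed.

Lemma linked_rcons u v b :
  locally_linked u v -> locally_linked (rcons u b) (rcons v b).
Proof.
case=> {u v} [h u v Hh huv|u v h0 h1]; last by case: b.
exact: LinkedBy Hh (linear_on_rcons huv).
Qed.

Lemma linked_trans u v w :
  locally_linked u v -> locally_linked v w -> locally_linked u w.
Proof.
move=> uv; elim: uv w => {u v} [h u v Hh huv|u v _ IH0 _ IH1] w vw; last first.
  by apply: LinkedSplit; [apply: IH0 | apply: IH1]; apply: linked_rcons.
elim: vw u huv => {v w} [g v w Hg gvw|v w _ IH0 _ IH1] u huv.
  exact: LinkedBy (subgroupM sH Hh Hg) (linear_on_mul huv gvw).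
by apply: LinkedSplit; [apply: IH0 | apply: IH1]; apply: linear_on_rcons.
Qed.

Variable S : set tree_diagram.
Hypothesis realS : forall D, S D -> exists2 h, H h & represents D h.

(** The added common root stands for the empty word, like the roots it is glued
to. *)
Definition vertex_word (x : raw_vertex) : word :=
  if x is TreeVertex _ _ u then u else [::].

(** Each rule that identifies vertices preserves [locally_linked]: leaves are
glued by a generator of H, foldings of the first kind pass to children, and those
of the second kind are bisections. *)
Lemma same_vertex_linked (x y : raw_vertex) :
  same_vertex S x y -> locally_linked (vertex_word x) (vertex_word y).
Proof.
have edgeE p b q : raw_edge S p b q -> vertex_word q = rcons (vertex_word p) b.
  by case.
elim=> {x y} [x y|x y _|x y z _ xy _|x y x0 x1 y0 y1].
- elim=> {x y} [x|x y _|x y z _ xy _|x y|x y b x' y' _ xy /edgeE -> /edgeE ->].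
  + exact: linked_refl.
  + exact: linked_sym.
  + exact: linked_trans.
  + case=> [D plus _|D u v SD uv]; first exact: linked_refl.
    by have [h Hh hD] := realS SD; apply: (LinkedBy Hh); apply: hD.
  + exact: linked_rcons.
- exact: linked_sym.
- exact: linked_trans.
- move=> /edgeE x0E /edgeE x1E /edgeE y0E /edgeE y1E _ + _.
  by rewrite x0E x1E y0E y1E; apply: LinkedSplit.
Qed.

Lemma walk_rconsV (V : Type) (edge : V -> bool -> V -> Prop) (x z : V) u b :
  walk edge x (rcons u b) z -> exists2 y, walk edge x u y & edge y b z.
Proof.
elim: u x => [|c u IH] x /=; first by case=> y e <-; exists x.
by case=> y e /IH[y' w e']; exists y' => //; exists y.
Qed.

(** A vertex of the core is a class of tree vertices, and any of its members is
linked to any word that is read there. *)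
Lemma reads_linked u (C : core_vertex S) : reads (A := core S) u C ->
  forall x : raw_vertex, sval C x -> locally_linked u (vertex_word x).
Proof.
elim/last_ind: u C => [|u b IH] C /=.
  by rewrite /reads /= => <- x /same_vertex_linked.
move=> uC; have [C' /IH{}IH [x [x' [C'x Cx' e]]]] := walk_rconsV uC.
move=> y Cy.
apply: linked_trans (same_vertex_linked (core_vertex_same Cx' Cy)).
have -> : vertex_word x' = rcons (vertex_word x) b by case: e.
by apply: linked_rcons; apply: IH.
Qed.

Lemma accepted_linked D u v : accepted (core S) D ->
  (u, v) \in branch_pairs D -> locally_linked u v.
Proof.
move=> [readD eqD] uv.
have uP : u \in branches (tree_of D true).
  have := map_f fst uv; rewrite -/(unzip1 _) unzip1_zip //.
  by rewrite (same_leaves D).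
have vP : v \in branches (tree_of D false).
  have := map_f snd uv; rewrite -/(unzip2 _) unzip2_zip //.
  by rewrite (same_leaves D).
have [C rC] := readD _ _ uP; have [C' rC'] := readD _ _ vP.
have CC' := eqD _ _ _ _ uv rC rC'; rewrite -CC' in rC'.
have [x _ CE] := svalP C.
have Cx : sval C x by rewrite CE; apply: same_refl.
exact: linked_trans (reads_linked rC Cx) (linked_sym (reads_linked rC' Cx)).
Qed.

(** The points of s divide [a, b] into the pieces; asking only for intervals that
avoid s, as in the definition of F, spares any ordering of s. *)
Definition piecewise f (a b : R) : Prop := exists s : seq R,
  (forall p, p \in s -> dyadic p) /\
  forall x y, a <= x -> x < y -> y <= b -> (forall p, p \in s -> ~~ (x < p < y)) ->
    exists2 h, H h & forall z, x <= z <= y -> f z = h z.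

Lemma piecewise_cat f a m b : dyadic m ->
  piecewise f a m -> piecewise f m b -> piecewise f a b.
Proof.
move=> dm [s [sd sP]] [t [td tP]]; exists (s ++ m :: t); split.
  by move=> p; rewrite mem_cat inE => /or3P[/sd|/eqP ->|/td].
move=> x y ax xy yb nb.
have := nb m; rewrite mem_cat inE eqxx orbT => /(_ isT).
rewrite negb_and -!leNgt => /orP[mx|ym].
  by apply: tP => // p pt; apply: nb; rewrite mem_cat inE pt !orbT.
by apply: sP => // p ps; apply: nb; rewrite mem_cat ps.
Qed.

Let left_end u : R := dyadic_point R u.
Let right_end u : R := dyadic_point R u + 2 ^- size u.

Lemma piecewise_split f u :
  piecewise f (left_end (rcons u false)) (right_end (rcons u false)) ->
  piecewise f (left_end (rcons u true)) (right_end (rcons u true)) ->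
  piecewise f (left_end u) (right_end u).
Proof.
rewrite /left_end /right_end !dyadic_point_rcons !size_rcons mul0r addr0 mul1r.
have -> : dyadic_point R u + 2 ^- (size u).+1 + 2 ^- (size u).+1 =
  dyadic_point R u + 2 ^- size u by rewrite exprS invfM; lra.
by apply: piecewise_cat; apply/dyadicD/dyadic_exp/dyadic_point_dyadic.
Qed.

Lemma linked_piecewise f u v : locally_linked u v -> linear_on f u v ->
  piecewise f (left_end u) (right_end u).
Proof.
elim=> {u v} [h u v Hh huv|u v _ IH0 _ IH1] fuv; last first.
  by apply: piecewise_split; [apply: IH0 | apply: IH1]; apply: linear_on_rcons.
exists [::]; split=> // x y ux xy yu _; exists h => // z /andP[xz zy].
have zu : in_dyadic_interval u z.
  by rewrite /in_dyadic_interval (le_trans ux xz) (le_trans zy yu).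
by rewrite fuv // huv.
Qed.

Lemma branches_piecewise f t w :
  (forall u, u \in branches t -> piecewise f (left_end (w ++ u)) (right_end (w ++ u))) ->
  piecewise f (left_end w) (right_end w).
Proof.
elim: t w => [|l IHl r IHr] w h /=; first by rewrite -(cats0 w); apply: h.
apply: piecewise_split.
  apply: IHl => u ul; rewrite -cats1 -catA; apply: h.
  by rewrite /= mem_cat map_f.
apply: IHr => u ur; rewrite -cats1 -catA; apply: h.
by rewrite /= mem_cat map_f // orbT.
Qed.

Lemma DG_core_piecewise f : DG (core S) R f -> piecewise f 0 1.
Proof.
move=> [D [_ fD aD]].
have := @branches_piecewise f (tree_plus D) [::].
rewrite /left_end /right_end /= expr0 invr1 add0r; apply=> u uD.
pose v := nth [::] (branches (tree_minus D)) (index u (branches (tree_plus D))).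
have uv : (u, v) \in branch_pairs D.
  have i : (index u (branches (tree_plus D)) < size (branch_pairs D))%N.
    by rewrite size_zip -(same_leaves D) minnn index_mem.
  rewrite -[u in (u, v)](nth_index [::] uD) -nth_zip ?(same_leaves D) //.
  exact: mem_nth.
exact: linked_piecewise (accepted_linked aD uv) (fD _ _ uv).
Qed.

End CorePieces.

(** * Accepted diagrams form a group *)

Section Grafting.
Implicit Types (t l r : tree) (ts : seq tree) (u v w : word) (us vs : seq word).

Lemma branches_gt0 t : (0 < size (branches t))%N.
Proof. by elim: t => //= l lP r _; rewrite size_cat size_map ltn_addr. Qed.

Fixpoint graft t ts : tree :=
  if t is Node l r then
    let n := size (branches l) in Node (graft l (take n ts)) (graft r (drop n ts))
  else head Leaf ts.

Definition graft_words us ts : seq word :=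
  flatten [seq [seq p.1 ++ w | w <- branches p.2] | p <- zip us ts].

Lemma graft_words_cons b us ts :
  graft_words (map (cons b) us) ts = map (cons b) (graft_words us ts).
Proof.
rewrite /graft_words; elim: us ts => [|u us IH] [|t ts] //=.
by rewrite map_cat IH -map_comp.
Qed.

Lemma graft_words_cat us us' ts ts' : size us = size ts ->
  graft_words (us ++ us') (ts ++ ts') = graft_words us ts ++ graft_words us' ts'.
Proof. by move=> sz; rewrite /graft_words zip_cat // map_cat flatten_cat. Qed.

Lemma branches_graft t ts : size ts = size (branches t) ->
  branches (graft t ts) = graft_words (branches t) ts.
Proof.
elim: t ts => [|l IHl r IHr] ts /=.
  case: ts => [|t [|]] //= _.
  by rewrite /graft_words /= cats0 map_id.
rewrite size_cat !size_map => sz.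
have szl : size (take (size (branches l)) ts) = size (branches l).
  by rewrite size_takel // sz leq_addr.
have szr : size (drop (size (branches l)) ts) = size (branches r).
  by rewrite size_drop sz addKn.
rewrite IHl // IHr // -!graft_words_cons -graft_words_cat ?cat_take_drop //.
by rewrite size_map szl.
Qed.

Lemma size_graft_words us vs ts : size us = size vs ->
  size (graft_words us ts) = size (graft_words vs ts).
Proof.
rewrite /graft_words; elim: us vs ts => [|u us IH] [|v vs] [|t ts] //= [sz].
by rewrite !size_cat !size_map (IH vs).
Qed.

Lemma zip_graft_words us vs ts u v : size us = size vs ->
  (u, v) \in zip (graft_words us ts) (graft_words vs ts) ->
  exists u' v' w, [/\ (u', v') \in zip us vs, u = u' ++ w & v = v' ++ w].
Proof.
rewrite /graft_words; elim: us vs ts => [|u1 us IH] [|v1 vs] [|t ts] //= [sz].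
rewrite zip_cat ?size_map // mem_cat => /orP[|/(IH _ _ sz)[u' [v' [w [uv -> ->]]]]].
  by rewrite zip_map => /mapP[w _ [-> ->]]; exists u1, v1, w; rewrite mem_head.
by exists u', v', w; rewrite inE uv orbT.
Qed.

(** The superposition of the two trees; each of its branches ends at a leaf of one
of them, which will make it readable. *)
Lemma common_refinement t t' : exists ts ts',
  [/\ size ts = size (branches t), size ts' = size (branches t'),
      graft t ts = graft t' ts' &
      forall u, u \in branches (graft t ts) -> u \in branches t \/ u \in branches t'].
Proof.
have graft_leaves s : graft s (nseq (size (branches s)) Leaf) = s.
  elim: s => //= l IHl r IHr; rewrite size_cat !size_map nseqD.
  by rewrite take_size_cat ?drop_size_cat ?size_nseq // IHl IHr.
elim: t t' => [|l IHl r IHr] t'.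
  exists [:: t'], (nseq (size (branches t')) Leaf).
  by rewrite /= size_nseq graft_leaves; split=> // u; right.
case: t' => [|l' r'].
  exists (nseq (size (branches (Node l r))) Leaf), [:: Node l r].
  by rewrite size_nseq graft_leaves; split=> // u; left.
have [ts [ts' [sz sz' E M]]] := IHl l'; have [us [us' [zs zs' E' M']]] := IHr r'.
exists (ts ++ us), (ts' ++ us').
rewrite /= !size_cat !size_map sz sz' zs zs' -sz -sz'.
rewrite !take_size_cat ?drop_size_cat // E E'; split=> // u.
rewrite !mem_cat => /orP[/mapP[w]|/mapP[w]].
  by rewrite -E => /M[] ? ->; [left | right]; rewrite map_f.
by rewrite -E' => /M'[] ? ->; [left | right]; rewrite map_f // orbT.
Qed.

Lemma mem_zip_trans us vs ws u w : size us = size vs -> size vs = size ws ->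
  (u, w) \in zip us ws ->
  exists2 v, (u, v) \in zip us vs & (v, w) \in zip vs ws.
Proof.
elim: us vs ws => [|a us IH] [|b vs] [|c ws] //= [sz] [sz'].
rewrite inE => /orP[/eqP[-> ->]|/(IH _ _ sz sz')[v uv vw]].
  by exists b; rewrite mem_head.
by exists v; rewrite inE ?uv ?vw orbT.
Qed.

Lemma mem_zipC us vs u v : (u, v) \in zip us vs -> (v, u) \in zip vs us.
Proof.
elim: us vs => [|a us IH] [|b vs] //=; rewrite !inE => /orP[/eqP[-> ->]|/IH ->].
  by rewrite eqxx.
by rewrite orbT.
Qed.

Lemma mem_zip12 us vs u v :
  (u, v) \in zip us vs -> u \in us /\ v \in vs.
Proof.
elim: us vs => [|a us IH] [|b vs] //=; rewrite !inE => /orP[/eqP[-> ->]|/IH[-> ->]].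
  by rewrite !eqxx.
by rewrite !orbT.
Qed.

Lemma mem_zip1 us vs u : size us = size vs -> u \in us ->
  exists v, (u, v) \in zip us vs.
Proof.
elim: us vs => [|a us IH] [|b vs] //= [sz]; rewrite inE => /orP[/eqP ->|].
  by exists b; rewrite mem_head.
by move=> /(IH _ sz)[v uv]; exists v; rewrite inE uv orbT.
Qed.

Lemma merge_siblings t i w : (i.+1 < size (branches t))%N ->
  nth [::] (branches t) i = rcons w false ->
  nth [::] (branches t) i.+1 = rcons w true ->
  exists t', branches t' = take i (branches t) ++ w :: drop i.+2 (branches t).
Proof.
have nth_head b us j : (j < size us)%N -> nth [::] (map (cons b) us) j = b :: nth [::] us j.
  by move=> ji; rewrite (nth_map [::]).
elim: t i w => [|l IHl r IHr] i w //=.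
rewrite size_cat !size_map => sz.
set n := size (branches l) in sz *; set m := size (branches r) in sz *.
rewrite !nth_cat !size_map -/n take_cat drop_cat !size_map -/n.
case: (ltnP i n) => iln; last first.
  rewrite ltnNge (leqW iln) /= ltnNge (leqW (leqW iln)) /=.
  have im : ((i - n).+1 < m)%N by lia.
  rewrite subSn // !subSn ?(leqW iln) // !nth_head -/m //; last by lia.
  case: w => [|b w] //= [] <- e1 [] e2.
  have [r' rE] := IHr _ _ im e1 e2.
  by exists (Node l r'); rewrite /= rE map_cat /= map_take map_drop catA.
rewrite nth_head //; case: (ltnP i.+1 n) => iln'.
  rewrite nth_head //; case: w => [|b w] //= [] <- e1 [] e2.
  have [l' lE] := IHl _ _ iln' e1 e2.
  exists (Node l' r); rewrite /= lE map_cat /= map_take map_drop -catA /=.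
  case: ltnP => // iln2.
  have -> : (i.+2 - n = 0)%N by lia.
  by rewrite drop0 drop_oversize // size_map -/n.
have iE : i.+1 = n by lia.
rewrite -iE subnn nth_head; last by lia.
case: w => [|b w] //= [] e1 [] e2; last by move: e1 e2 => <-.
have nilP t : [::] \in branches t -> t = Leaf.
  by case: t => //= t1 t2; rewrite mem_cat => /orP[] /mapP[].
have l0 : l = Leaf by apply: nilP; rewrite -e1 mem_nth.
have r0 : r = Leaf by apply: nilP; rewrite -e2 mem_nth // -/m; lia.
by move: iE; rewrite /n l0 r0 => -[->]; exists Leaf.
Qed.

End Grafting.

Section AcceptedGroup.
Variables (R : realType) (A : tree_automaton).
Implicit Types (f g : thompson R) (u v w : word) (D : tree_diagram).

Lemma walk_cat (x z : vertex A) u w : walk (@edge A) x (u ++ w) z <->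
  exists2 y, walk (@edge A) x u y & walk (@edge A) y w z.
Proof.
elim: u x => [|b u IH] x /=; first by split=> [|[y ->]]; [exists x | ].
split=> [[y e /IH[y' uy wz]]|[y [y' e uy wz]]].
  by exists y' => //; exists y.
by exists y' => //; apply/IH; exists y.
Qed.

Lemma walk_fun (x y z : vertex A) u :
  walk (@edge A) x u y -> walk (@edge A) x u z -> y = z.
Proof.
elim: u x => [|b u IH] x /=; first by move=> <-.
move=> [y' e uy] [z' e' uz]; move: uz.
by rewrite -(edge_fun e e'); apply: IH.
Qed.

(** This folds both clauses of acceptance, readability and u^+ = v^+, into one
property of a pair of branches. *)
Definition meet_at u v : Prop := exists2 x, reads (A := A) u x & reads (A := A) v x.

Lemma accepted_meet D :
  accepted A D <-> forall u v, (u, v) \in branch_pairs D -> meet_at u v.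
Proof.
split=> [[rD eD] u v uv|h].
  have [uD vD] := mem_zip12 uv.
  have [x ux] := rD true u uD; have [y vy] := rD false v vD.
  by exists x => //; rewrite (eD u v x y).
split=> [[] u uD|u v x y uv ux vy].
- have [v /h[x ux _]] := mem_zip1 (same_leaves D) uD; by exists x.
- have [v /mem_zipC/h[x _ ux]] := mem_zip1 (esym (same_leaves D)) uD; by exists x.
have [z uz vz] := h u v uv.
by rewrite (walk_fun ux uz) (walk_fun vy vz).
Qed.

Lemma meet_at_sym u v : meet_at u v -> meet_at v u.
Proof. by case=> x ux vx; exists x. Qed.

Lemma meet_at_trans u v w : meet_at u v -> meet_at v w -> meet_at u w.
Proof.
by case=> x ux vx [y vy wy]; exists x => //; rewrite (walk_fun vx vy).
Qed.

Lemma meet_at_cat u v w : meet_at u v -> readable A (v ++ w) ->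
  meet_at (u ++ w) (v ++ w).
Proof.
case=> x ux vx [z vwz]; exists z => //; apply/walk_cat.
have /walk_cat[y vy yz] := vwz; exists y => //.
by rewrite (walk_fun vy vx).
Qed.

Definition diagrammable f : Prop := exists2 D, represents D f & accepted A D.

Lemma linear_on_cat f u v w : linear_on f u v -> linear_on f (u ++ w) (v ++ w).
Proof.
move=> fuv; elim/last_ind: w => [|w b IH]; first by rewrite !cats0.
by rewrite -!rcons_cat; apply: linear_on_rcons.
Qed.

(** For a product, the middle trees are grafted into their common refinement.
Its branches are readable, and reading on from a common end vertex carries
readability over to the two outer trees. *)
Lemma diagrammable_subgroup : subgroup diagrammable.
Proof.
apply: subgroupP => [|f g [D fD aD] [E gE aE]|f [D fD aD]]; last first.
- exists (TreeDiagram (esym (same_leaves D))).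
    by move=> u v /mem_zipC/fD h; apply: linear_on_inv.
  apply/accepted_meet => u v /mem_zipC.
  by move/accepted_meet: aD => h /h; apply: meet_at_sym.
- have [ts [ts' [sz sz' EM rM]]] := common_refinement (tree_minus D) (tree_plus E).
  have rM' w : w \in branches (graft (tree_minus D) ts) -> readable A w.
    by move=> /rM[]; [apply: (aD.1 false) | apply: (aE.1 true)].
  have [sD sE] := (same_leaves D, same_leaves E).
  have sD' : size ts = size (branches (tree_plus D)) by rewrite sz.
  have sE' : size ts' = size (branches (tree_minus E)) by rewrite sz'.
  have s1 : size (branches (graft (tree_plus D) ts)) =
      size (branches (graft (tree_minus D) ts)).
    by rewrite !branches_graft //; apply: size_graft_words.
  have s2 : size (branches (graft (tree_minus D) ts)) =
      size (branches (graft (tree_minus E) ts')).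
    by rewrite EM !branches_graft //; apply: size_graft_words.
  exists (TreeDiagram (etrans s1 s2)).
    move=> u w /(mem_zip_trans s1 s2)[v]; rewrite {2}EM /= !branches_graft //.
    move=> /(zip_graft_words sD)[u1 [v1 [a [/fD uv -> vE]]]].
    move=> /(zip_graft_words sE)[v2 [w1 [b [/gE vw vE' ->]]]].
    apply: linear_on_mul (linear_on_cat (w := a) uv) _.
    by rewrite -vE vE'; apply: linear_on_cat.
  apply/accepted_meet => u w /(mem_zip_trans s1 s2)[v] h1 h2.
  have rv : readable A v by apply: rM'; case: (mem_zip12 h1).
  apply: (@meet_at_trans _ v).
    move: h1; rewrite /= !branches_graft //.
    move=> /(zip_graft_words sD)[u1 [v1 [a [uv -> vE]]]].
    move: rv; rewrite vE; apply: meet_at_cat.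
    by move/accepted_meet: aD; apply.
  apply: meet_at_sym; move: h2; rewrite /= EM !branches_graft //.
  move=> /(zip_graft_words sE)[v2 [w1 [b [vw vE ->]]]].
  move: rv; rewrite vE; apply: meet_at_cat; apply: meet_at_sym.
  by move/accepted_meet: aE; apply.
- exists (@TreeDiagram Leaf Leaf erefl).
    by move=> u v; rewrite inE => /eqP[-> ->]; apply: linear_on_id.
  apply/accepted_meet => u v; rewrite inE => /eqP[-> ->].
  by exists (Defs.root A).
Qed.

Lemma linear_on_siblings f u v : linear_on f (rcons u false) (rcons v false) ->
  linear_on f (rcons u true) (rcons v true) -> linear_on f u v.
Proof.
move=> h0 h1 x; rewrite /in_dyadic_interval => /andP[ux xu].
have e2 : 2 ^- size u = 2 * 2 ^- (size u).+1 :> R.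
  by rewrite exprS invfM mulrA divff ?mul1r // pnatr_eq0.
case: (leP x (dyadic_point R u + 2 ^- (size u).+1)) => xm.
  rewrite h0 ?/in_dyadic_interval !dyadic_point_rcons !size_rcons mul0r !addr0.
    by rewrite mul0r addr0 !exprS; field; rewrite !expf_neq0 // pnatr_eq0.
  by rewrite ux.
rewrite h1 ?/in_dyadic_interval !dyadic_point_rcons !size_rcons !mul1r.
  by rewrite !exprS; field; rewrite !expf_neq0 // pnatr_eq0.
by rewrite ltW //=; lra.
Qed.

(** This is where fathers with the same children have to be equal. *)
Lemma meet_at_siblings u v : meet_at (rcons u false) (rcons v false) ->
  meet_at (rcons u true) (rcons v true) -> meet_at u v.
Proof.
case=> x0 ux0 vy0 [x1 ux1 vy1].
have [x ux e0] := walk_rconsV ux0; have [y vy e0'] := walk_rconsV vy0.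
have [x' ux' e1] := walk_rconsV ux1; have [y' vy' e1'] := walk_rconsV vy1.
rewrite -(walk_fun ux ux') in e1; rewrite -(walk_fun vy vy') in e1'.
by exists x => //; rewrite (edge_inj e0 e1 e0' e1').
Qed.

(** Induction on the number of leaves, removing common sibling pairs. *)
Lemma diagrammable_DG f : diagrammable f -> DG A R f.
Proof.
case=> D; move: {2}(size (branches (tree_plus D))) (leqnn (size (branches (tree_plus D)))) => n.
elim: n D => [|n IHn] D len fD aD; first by have := branches_gt0 (tree_plus D); rewrite ltnNge len.
have [rD|nrD] := pselect (reduced D); first by exists D.
have [i [ip [w [p0 p1]] [w' [m0 m1]]]] := contrapT nrD.
have im := ip; rewrite /= (same_leaves D) in im.
have [t tE] := merge_siblings ip p0 p1; have [t' tE'] := merge_siblings im m0 m1.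
have sD := same_leaves D.
have szt : size (branches t) = (size (branches (tree_plus D))).-1.
  rewrite tE size_cat /= size_drop size_takel; last exact: ltnW (ltnW ip).
  by rewrite /= in ip; lia.
have sE : size (branches t) = size (branches t').
  by rewrite tE tE' !size_cat /= !size_take !size_drop sD.
have pairE u v : (u, v) \in branch_pairs (TreeDiagram sE) ->
    (u, v) = (w, w') \/ (u, v) \in branch_pairs D.
  rewrite /branch_pairs /= tE tE' zip_cat ?size_take ?sD // mem_cat /= inE.
  case/or3P => [h|/eqP -> |h]; [right | by left | right].
    rewrite -(cat_take_drop i (branches (tree_plus D))).
    rewrite -(cat_take_drop i (branches (tree_minus D))).
    by rewrite zip_cat ?size_take ?sD // mem_cat h.
  rewrite -(cat_take_drop i.+2 (branches (tree_plus D))).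
  rewrite -(cat_take_drop i.+2 (branches (tree_minus D))).
  by rewrite zip_cat ?size_take ?sD // mem_cat h orbT.
have pair j : (j < size (branches (tree_plus D)))%N ->
    (nth [::] (branches (tree_plus D)) j, nth [::] (branches (tree_minus D)) j)
    \in branch_pairs D.
  move=> jp; rewrite -nth_zip //; apply: mem_nth.
  by rewrite size_zip -sD minnn.
have := pair _ (ltnW ip); rewrite p0 m0 => q0.
have := pair _ ip; rewrite p1 m1 => q1.
apply: (IHn (TreeDiagram sE)).
- by rewrite /= szt; lia.
- move=> u v /pairE[[-> ->]|/fD//].
  exact: linear_on_siblings (fD _ _ q0) (fD _ _ q1).
- move/accepted_meet: aD => aD; apply/accepted_meet => u v /pairE[[-> ->]|/aD//].
  exact: meet_at_siblings (aD _ _ q0) (aD _ _ q1).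
Qed.

End AcceptedGroup.

Section CoreAccepts.
Variable S : set tree_diagram.

Lemma branch_vertex t u : u \in branches t -> vertex_of t u.
Proof.
elim: t u => [|l IHl r IHr] u /=; first by rewrite inE => /eqP ->.
by rewrite mem_cat => /orP[] /mapP[w wt ->] /=; [apply: IHl | apply: IHr].
Qed.

Lemma reads_vertex D plus u : S D -> vertex_of (tree_of D plus) u ->
  exists2 C : core_vertex S, sval C (TreeVertex D plus u) & reads (A := core S) u C.
Proof.
move=> SD; elim/last_ind: u => [|u b IH] Du.
  exists (core_root S) => //.
  by apply: Fold2Fold1; apply: Fold1Glue; constructor.
have [C Cu uC] := IH (vertex_of_rcons Du).
have [C' C'u] := @core_vertex_ex S (TreeVertex D plus (rcons u b)) (conj SD Du).
exists C' => //; apply: walk_rcons uC _.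
by exists (TreeVertex D plus u), (TreeVertex D plus (rcons u b)).
Qed.

(** Reading a branch in the core follows the tree, and the two ends of a pair of
branches are glued. *)
Lemma core_accepts D : S D -> accepted (core S) D.
Proof.
move=> SD; apply/accepted_meet => u v uv.
have [/branch_vertex uD /branch_vertex vD] := mem_zip12 uv.
have [C Cu uC] := @reads_vertex D true u SD uD.
have [C' Cv vC'] := @reads_vertex D false v SD vD.
suff CC' : C = C' by exists C => //; rewrite CC'.
by apply: (core_vertex_eq Cu Cv); apply: Fold2Fold1; apply: Fold1Glue; constructor.
Qed.

Lemma generated_sub_DG (R : realType) :
  generated [set f : thompson R | exists2 D, S D & represents D f] `<=` DG (core S) R.
Proof.
move=> f Gf; apply: diagrammable_DG; move: f Gf.
apply: smallest_sub; first exact: diagrammable_subgroup.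
by move=> f [D SD fD]; exists D => //; apply: core_accepts.
Qed.

End CoreAccepts.

(** * Supports, orbits and germs *)

Section Dynamics.
Variable R : realType.
Implicit Types (f g h k : thompson R) (K : set (thompson R)) (a b c d e s t x y z : R).

Lemma list_gap (s : seq R) x :
  exists2 e, 0 < e & forall p, p \in s -> p != x -> e <= `|p - x|.
Proof.
elim: s => [|p s [e e0 IH]]; first by exists 1.
have [->|px] := eqVneq p x.
  by exists e => // q; rewrite inE => /orP[/eqP -> /eqP//|/IH].
exists (Num.min e `|p - x|); first by rewrite lt_min e0 normr_gt0 subr_eq0.
move=> q; rewrite inE => /orP[/eqP -> _|/IH h /h eq]; rewrite ge_min ?lexx ?orbT //.
by rewrite eq.
Qed.

Lemma exp2_small e : 0 < e -> exists n, 2 ^- n < e.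
Proof.
move=> e0; exists (Num.trunc e^-1).+1.
rewrite -[ltRHS]invrK ltf_pV2 ?posrE ?invr_gt0 ?exprn_gt0 //.
have /andP[_ h] := truncn_itv (ltW (etrans (invr_gt0 e) e0)).
apply: lt_le_trans h _; rewrite -natrX ler_nat.
exact: ltnW (ltn_expl _ _).
Qed.

Lemma thompson_dyadic_all f x : dyadic x -> dyadic (f x).
Proof.
move=> dx; have [x01|] := boolP (0 <= x <= 1).
  exact: (thompson_dyadic (thompsonP f)).
by rewrite negb_and -!ltNge => h; rewrite thompson_out //; case/orP: h => /ltW; auto.
Qed.

Definition supp_in a b f : Prop := forall x, x <= a \/ b <= x -> f x = x.

Lemma supp_in1 a b : supp_in a b 1%g.
Proof. by move=> x. Qed.

Lemma supp_inM a b f g : supp_in a b f -> supp_in a b g -> supp_in a b (f * g)%g.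
Proof. by move=> fS gS x xab; rewrite tmulE fS // gS. Qed.

Lemma supp_inV a b f : supp_in a b f -> supp_in a b f^-1%g.
Proof. by move=> fS x /fS fx; apply: tfixV. Qed.

Lemma supp_in_subgroup a b : subgroup (supp_in a b).
Proof. by apply: subgroupP; [apply: supp_in1|apply: supp_inM|apply: supp_inV]. Qed.

Lemma supp_in_sub a b a' b' f : a' <= a -> b <= b' ->
  supp_in a b f -> supp_in a' b' f.
Proof.
move=> aa bb fS x [xa|bx]; apply: fS; [left|right].
  exact: le_trans aa.
exact: le_trans bx.
Qed.

Lemma supp_inJ a b f g : supp_in a b f -> supp_in (g a) (g b) (f ^ g)%g.
Proof.
move=> fS x xab; rewrite tconjE fS ?tinvKV //.
by rewrite -(thompson_le g) -(thompson_le g b) tinvKV.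
Qed.

Lemma supp_in_itv a b f x : supp_in a b f -> a < x < b -> a < f x < b.
Proof.
move=> fS /andP[ax xb].
rewrite -{1}(fS a) ?lexx; last by left.
by rewrite -[X in _ && (_ < X)](fS b) ?lexx ?thompson_lt ?ax //; right.
Qed.

Lemma conj_eq_on a b (n f g : thompson R) : supp_in a b n ->
  (forall y, a <= y <= b -> f y = g y) -> (n ^ f)%g = (n ^ g)%g.
Proof.
move=> nS fg; apply: thompson_eqP => y; rewrite !tconjE.
have [/andP[az zb]|zab] := boolP (a < (f^-1)%g y < b).
  have <- : (f^-1)%g y = (g^-1)%g y.
    by apply: (canRL (tinvK g)); rewrite -fg ?tinvKV // !ltW.
  have /andP[/ltW ? /ltW ?] := supp_in_itv nS (introT andP (conj az zb)).
  by rewrite fg //; apply/andP.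
have fixn w : ~~ (a < w < b) -> n w = w.
  by rewrite negb_and -!leNgt => /orP[wa|bw]; apply: nS; [left|right].
rewrite (fixn _ zab) tinvKV fixn ?tinvKV //; apply: contra zab => /andP[aw wb].
set w := (g^-1)%g y in aw wb.
have fw : f w = y by rewrite fg ?(ltW aw) ?(ltW wb) //; apply: tinvKV.
by have -> : (f^-1)%g y = w; [rewrite -fw tinvK | rewrite aw].
Qed.

Lemma supp_in_commute a b (c : R) d f g : supp_in a b f -> supp_in c d g -> b <= c ->
  (f * g = g * f)%g.
Proof.
move=> fS gS bc; apply: thompson_eqP => x; rewrite !tmulE.
have [xb|bx] := leP x b.
  have gx : g x = x by apply: gS; left; apply: le_trans bc.
  rewrite gx gS //; left; apply: le_trans bc.
  by rewrite -(fS b) ?thompson_le //; right.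
rewrite (fS x); last by right; apply: ltW.
rewrite fS //; right; rewrite -(gS b); last by left.
by rewrite thompson_le ltW.
Qed.

Lemma fix_sup f (S : set R) : has_sup S -> (forall x, S x -> f x = x) ->
  f (sup S) = sup S.
Proof.
move=> [S0 Sb] fS; apply/eqP; rewrite eq_le !leNgt; apply/andP; split; apply/negP.
  rewrite tgtV => /(sup_gt S0)[z Sz]; rewrite -tgtV fS // ltNge.
  by rewrite ub_le_sup.
move=> /(sup_gt S0)[z Sz]; rewrite -{1}(fS z Sz) thompson_lt ltNge.
by rewrite ub_le_sup.
Qed.

Lemma fix_inf f (S : set R) : has_inf S -> (forall x, S x -> f x = x) ->
  f (inf S) = inf S.
Proof.
move=> [S0 Sb] fS; apply/eqP; rewrite eq_le !leNgt; apply/andP; split; apply/negP.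
  move=> /(inf_lt S0)[z Sz]; rewrite -{1}(fS z Sz) thompson_lt ltNge.
  by rewrite ge_inf.
rewrite tltV => /(inf_lt S0)[z Sz]; rewrite -tltV fS // ltNge.
by rewrite ge_inf.
Qed.

(** If every point between x and y is moved by some element of the subgroup K,
then K takes x beyond y: otherwise the supremum of the orbit of x would be
fixed by all of K. *)
Lemma orbit_above K x y : subgroup K ->
  (forall z, x <= z <= y -> exists2 g, K g & g z != z) ->
  exists2 g, K g & y < g x.
Proof.
move=> sK moved; apply: contrapT => no.
have leY g : K g -> g x <= y.
  by move=> Kg; rewrite leNgt; apply/negP => yg; apply: no; exists g.
pose S := [set g x | g in K].
have Sx : S x by exists 1%g => //; apply: subgroup1.
have supS : has_sup S.
  by split; [exists x | exists y => _ [g Kg <-]; apply: leY].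
set m := sup S.
have xm : x <= m by apply: ub_le_sup; [case: supS|].
have my : m <= y by apply: ge_sup => [|_ [g Kg <-]]; [exists x | apply: leY].
have fixm g : K g -> g m <= m.
  move=> Kg; rewrite leNgt tgtV; apply/negP => h.
  have [_ [k Kk <-] kx] := sup_gt (ex_intro _ x Sx) h.
  have : g (k x) <= m.
    apply: ub_le_sup; first by case: supS.
    by exists (k * g)%g => //; apply: subgroupM.
  by rewrite leNgt tgtV kx.
have [g Kg /eqP[]] : exists2 g, K g & g m != m by apply: moved; rewrite xm.
apply/eqP; rewrite eq_le fixm //= tgeV.
by apply: fixm; apply: subgroupV.
Qed.

(** The inverse of an element that takes y beyond x. *)
Lemma orbit_below K x y : subgroup K ->
  (forall z, y <= z <= x -> exists2 g, K g & g z != z) ->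
  exists2 g, K g & g x < y.
Proof.
move=> sK /(orbit_above sK)[g Kg yg].
by exists (g^-1)%g; [apply: subgroupV | rewrite -tgtV].
Qed.

Lemma bump_at a b x : 0 <= a -> b <= 1 -> a < x < b ->
  exists2 f, supp_in a b f & f x != x.
Proof.
move=> a0 b1 /andP[ax xb].
have [n dn] : exists n, 2 ^- n < Num.min (x - a) (b - x) / 4.
  by apply: exp2_small; rewrite divr_gt0 // lt_min !subr_gt0 ax.
set d : R := 2 ^- n in dn; have d0 : 0 < d by rewrite exp2_gt0.
have [d1 d2] : 4 * d < x - a /\ 4 * d < b - x.
  by move: dn; rewrite ltr_pdivlMr // lt_min => /andP[? ?]; split; lra.
pose m := Num.floor (x / d); pose p : R := (m - 1)%:~R * d.
have /andP[h1 h2] : p + d <= x < p + 2 * d.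
  have /andP[m1 m2] := floor_itv (x / d).
  rewrite ler_pdivlMr // in m1; rewrite intrD ltr_pdivrMr // in m2.
  by rewrite /p intrB; apply/andP; split; lra.
have dp : dyadic p by exists (m - 1), n.
have dd : dyadic d by apply: dyadic_exp.
have [||f [fS fmove _ _]] := thompson_bump dp dd d0; [lra|lra|].
exists f; first by apply: supp_in_sub fS; lra.
by rewrite lt_eqF // fmove //; apply/andP; split; lra.
Qed.

(** First move x below b, then move it up beyond a with elements that fix a point
c of (a, b), and so cannot overshoot. *)
Lemma orbit_dense a b x : 0 < x < 1 -> 0 <= a -> a < b -> b <= 1 ->
  exists f : thompson R, a < f x < b.
Proof.
move=> /andP[x0 x1] a0 ab b1.
have [f0 fxb f0x] : exists2 f : thompson R, f x < b & 0 < f x.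
  have sT : subgroup [set: thompson R] by apply: subgroupP.
  have [z /andP[bz zx]|f _ fxb] := @orbit_below setT x (b / 2) sT.
    have z01 : 0 < z < 1 by apply/andP; split; lra.
    by have [f _ fz] := bump_at (lexx 0) (lexx 1) z01; exists f.
  exists f; first lra.
  have : 0 < f x < 1 by rewrite thompson01 x0.
  by case/andP.
case: (ltP a (f0 x)) => [h|f0a]; first by exists f0; rewrite h.
pose c := (a + b) / 2; set w := f0 x in fxb f0x f0a *.
have [|g gS ag] := orbit_above (supp_in_subgroup (w / 2) c) (x := w) (y := a).
  move=> z /andP[wz za]; apply: bump_at; rewrite /c; [lra|lra|].
  by apply/andP; split; lra.
exists (f0 * g)%g; rewrite tmulE -/w ag /=.
have /andP[_] : w / 2 < g w < c.
  by apply: supp_in_itv gS _; rewrite /c; apply/andP; split; lra.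
by rewrite /c; lra.
Qed.

(** The sign s, 1 for right and -1 for left, allows both sides of the fixed point
x to be treated at once. *)
Definition germ s f x a : Prop :=
  exists2 e, 0 < e & forall t, 0 <= t <= e -> f (x + s * t) = x + s * (a * t).

Lemma germ_ex s f x : (s = 1 /\ 0 <= x < 1) \/ (s = -1 /\ 0 < x <= 1) -> f x = x ->
  exists k : int, germ s f x (2 ^ k).
Proof.
have [ps [_ psP]] := thompson_pl (thompsonP f); have [e e0 eP] := list_gap ps x.
case=> [[-> /andP[x0 x1]]|[-> /andP[x0 x1]]] fx.
  pose y := Num.min (x + e) 1.
  have xy : x < y by rewrite lt_min x1 andbT; lra.
  have [||k [c kc]] := psP x y x0 xy; first by rewrite ge_min lexx orbT.
    move=> p /eP pe; apply/negP => /andP[xp]; rewrite lt_min => /andP[pxe _].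
    by have := pe (negbT (gt_eqF xp)); rewrite gtr0_norm ?subr_gt0 //; lra.
  exists k, (y - x) => [|t /andP[t0 ty]]; first by rewrite subr_gt0.
  have := kc x; rewrite fx lexx ltW // => /(_ isT) xE.
  by rewrite !mul1r kc; [rewrite [in RHS]xE; ring | apply/andP; split; lra].
pose y := Num.max (x - e) 0.
have yx : y < x by rewrite gt_max x0 andbT; lra.
have y0 : 0 <= y by rewrite le_max lexx orbT.
have [|k [c kc]] := psP y x y0 yx x1.
  move=> p /eP pe; apply/negP => /andP[]; rewrite gt_max => /andP[pxe _] px.
  by have := pe (negbT (lt_eqF px)); rewrite ltr0_norm ?subr_lt0 //; lra.
exists k, (x - y) => [|t /andP[t0 ty]]; first by rewrite subr_gt0.
have := kc x; rewrite fx lexx ltW // => /(_ isT) xE.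
by rewrite !mulN1r kc; [rewrite [in RHS]xE; ring | apply/andP; split; lra].
Qed.

Lemma germ1 s x : germ s 1%g x 1.
Proof. by exists 1 => // t _; rewrite toneE mul1r. Qed.

Lemma germM s f g x a b : 0 < a -> germ s f x a -> germ s g x b ->
  germ s (f * g)%g x (a * b).
Proof.
move=> a0 [e e0 fE] [e' e'0 gE]; exists (Num.min e (e' / a)).
  by rewrite lt_min e0 divr_gt0.
move=> t /andP[t0]; rewrite le_min ler_pdivlMr // => /andP[te te'].
rewrite tmulE fE ?t0 // gE; first by ring.
by rewrite mulr_ge0 ?(ltW a0) //= mulrC.
Qed.

Lemma germV s f x a : 0 < a -> germ s f x a -> germ s f^-1%g x a^-1.
Proof.
move=> a0 [e e0 fE]; exists (a * e); first by rewrite mulr_gt0.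
move=> t /andP[t0 te]; apply: (@tinj _ f); rewrite tinvKV fE.
  by rewrite mulVKf // gt_eqF.
by rewrite mulr_ge0 ?invr_ge0 ?(ltW a0) //= mulrC ler_pdivrMr // mulrC.
Qed.

Lemma germ_fun s f x a b : s != 0 -> germ s f x a -> germ s f x b -> a = b.
Proof.
move=> s0 [e e0 fE] [e' e'0 fE']; pose t := Num.min e e'.
have t0 : 0 < t by rewrite lt_min e0.
have := fE t; rewrite ltW //= ge_min lexx => /(_ isT).
rewrite fE'; last by rewrite ltW //= ge_min lexx orbT.
by move/addrI/(mulfI s0)/(mulIf (lt0r_neq0 t0)).
Qed.

Definition agree f g x : Prop :=
  exists2 e, 0 < e & forall y, x - e <= y <= x + e -> f y = g y.

Lemma agree_refl f x : agree f f x.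
Proof. by exists 1. Qed.

Lemma agreeM f g f' g' x : agree f f' x -> agree g g' (f x) ->
  agree (f * g)%g (f' * g')%g x.
Proof.
move=> [e e0 fE] [e' e'0 gE].
(* f maps [x - r, x + r] into the interval of radius e' about f x *)
pose r := Num.min e (Num.min ((f^-1)%g (f x + e') - x) (x - (f^-1)%g (f x - e'))).
exists r.
  by rewrite !lt_min e0 !subr_gt0 -tltV -tgtV; apply/andP; split; lra.
have [h1 h2 h3] : [/\ r <= e, r <= (f^-1)%g (f x + e') - x & r <= x - (f^-1)%g (f x - e')].
  by rewrite /r !ge_min !lexx !orbT.
move=> y /andP[xy yx]; rewrite !tmulE -fE; last by apply/andP; split; lra.
by rewrite gE //; apply/andP; split; [rewrite tgeV | rewrite tleV]; lra.
Qed.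

Lemma agreeV f g x : agree f g x -> agree f^-1%g g^-1%g (f x).
Proof.
move=> [e e0 fE].
pose r := Num.min (f (x + e) - f x) (f x - f (x - e)).
exists r; first by rewrite lt_min !subr_gt0 !thompson_lt; apply/andP; split; lra.
have [h1 h2] : r <= f (x + e) - f x /\ r <= f x - f (x - e).
  by rewrite /r !ge_min !lexx !orbT.
move=> y /andP[xy yx]; apply: (@tinj _ g); rewrite tinvKV -fE ?tinvKV //.
by apply/andP; split; [rewrite -tleV | rewrite -tgeV]; lra.
Qed.

Lemma agree_germs f g x a b : germ 1 f x a -> germ 1 g x a ->
  germ (-1) f x b -> germ (-1) g x b -> agree f g x.
Proof.
move=> [e1 e10 h1] [e2 e20 h2] [e3 e30 h3] [e4 e40 h4].
pose r := Num.min (Num.min e1 e2) (Num.min e3 e4).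
exists r; first by rewrite !lt_min e10 e20 e30.
have [r1 r2] : r <= e1 /\ r <= e2 by rewrite /r !ge_min !lexx !orbT.
have [r3 r4] : r <= e3 /\ r <= e4 by rewrite /r !ge_min !lexx !orbT.
move=> y /andP[xy yx]; case: (leP x y) => h.
  have -> : y = x + 1 * (y - x) by ring.
  by rewrite h1 ?h2 //; apply/andP; split; lra.
have -> : y = x + -1 * (x - y) by ring.
by rewrite h3 ?h4 //; apply/andP; split; lra.
Qed.

Lemma agree_germ s f g x a : s = 1 \/ s = -1 -> agree f g x -> germ s f x a -> germ s g x a.
Proof.
move=> s1 [e e0 fg] [e' e'0 fE]; pose r := Num.min e e'.
have [r1 r2] : r <= e /\ r <= e' by rewrite /r !ge_min !lexx !orbT.
exists r => [|t /andP[t0 tr]]; first by rewrite lt_min e0.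
rewrite -fE; last by apply/andP; split; lra.
rewrite fg //.
by case: s1 => ->; rewrite ?mul1r ?mulN1r; apply/andP; split; lra.
Qed.

(** All powers of 2 are realized as slopes by powers of a single bump. *)
Lemma germ_pow s x a b c f : 0 < c -> supp_in a b f -> germ s f x c ->
  forall k : int, exists2 g, supp_in a b g & germ s g x (c ^ k).
Proof.
move=> c0 fS fc.
have pow n : exists2 g, supp_in a b g & germ s g x (c ^+ n).
  elim: n => [|n [g gS gc]]; first by exists 1%g; [apply: supp_in1 | apply: germ1].
  exists (f * g)%g; first exact: supp_inM.
  by rewrite exprS; apply: germM.
case=> n; first exact: pow.
have [g gS gc] := pow n.+1; exists (g^-1)%g; first exact: supp_inV.
by rewrite NegzE -exprnN; apply: germV => //; rewrite exprn_gt0.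
Qed.

End Dynamics.

(** * Elements that are the identity near 0 and 1 *)

Section CompactSupport.
Variable R : realType.
Implicit Types (f g h : thompson R) (a b x y z : R).

Definition compact_supp f : Prop :=
  exists2 a, 0 < a & exists2 b, b < 1 & supp_in a b f.

Lemma compact_supp_subgroup : subgroup compact_supp.
Proof.
have sub a b a' b' : Num.min a a' <= a /\ b <= Num.max b b' by rewrite ge_min le_max !lexx.
apply: subgroupP => [|f g|f].
- by exists (1 / 2); [|exists (1 / 2)]; rewrite ?supp_in1 //; lra.
- move=> [a a0 [b b1 fS]] [a' a'0 [b' b'1 gS]].
  exists (Num.min a a'); first by rewrite lt_min a0.
  exists (Num.max b b'); first by rewrite gt_max b1.
  by apply: supp_inM; [apply: supp_in_sub fS | apply: supp_in_sub gS];
    rewrite ?ge_min ?le_max lexx ?orbT.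
- by move=> [a a0 [b b1 fS]]; exists a => //; exists b => //; apply: supp_inV.
Qed.

Lemma thompson_gt0 f a : 0 < a -> 0 < f a.
Proof. by rewrite -{2}(thompson0 (thompsonP f)) thompson_lt. Qed.

Lemma thompson_lt1 f a : a < 1 -> f a < 1.
Proof. by rewrite -{2}(thompson1 (thompsonP f)) thompson_lt. Qed.

Lemma compact_suppJ f g : compact_supp f -> compact_supp (f ^ g)%g.
Proof.
move=> [a a0 [b b1 fS]]; exists (g a); first exact: thompson_gt0.
by exists (g b); [apply: thompson_lt1 | apply: supp_inJ].
Qed.

Lemma compact_supp_germs f : germ 1 f 0 1 -> germ (-1) f 1 1 -> compact_supp f.
Proof.
move=> [e e0 fe] [e' e'0 fe']; exists e => //; exists (1 - e'); first by lra.
move=> x [xe|ex].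
  case: (leP x 0) => x0; first by rewrite thompson_out //; left.
  by have := fe x; rewrite ltW // xe !add0r !mul1r; apply.
case: (leP 1 x) => x1; first by rewrite thompson_out //; right.
have := fe' (1 - x); rewrite !mul1r !mulN1r !opprB ![1 + _]addrC !subrK; apply.
by apply/andP; split; lra.
Qed.

Lemma end_germs f : exists (k j : int), germ 1 f 0 (2 ^ k) /\ germ (-1) f 1 (2 ^ j).
Proof.
have [|k kP] := @germ_ex R 1 f 0 _ (thompson0 (thompsonP f)).
  by left; rewrite lexx ltr01.
have [|j jP] := @germ_ex R (-1) f 1 _ (thompson1 (thompsonP f)).
  by right; rewrite lexx ltr01.
by exists k, j.
Qed.

(** At 0 and at 1 the germs commute, being linear. *)
Lemma derived_compact_supp : derived (thompson R) `<=` compact_supp.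
Proof.
apply: smallest_sub; first exact: compact_supp_subgroup.
move=> _ [f _ [g _ <-]]; have [k [j [f0 f1]]] := end_germs f.
have [k' [j' [g0 g1]]] := end_germs g.
have germR s x (a b : R) : 0 < a -> 0 < b -> germ s f x a -> germ s g x b ->
    germ s [~ f, g]%g x 1.
  move=> a0 b0 fa gb.
  have -> : 1 = a^-1 * (b^-1 * (a * b)) by field; rewrite !gt_eqF.
  apply: germM; rewrite ?invr_gt0 //; first exact: germV.
  apply: germM; rewrite ?invr_gt0 //; first exact: germV.
  exact: germM.
by apply: compact_supp_germs; [apply: germR f0 g0 | apply: germR f1 g1];
  rewrite exprz_gt0.
Qed.

Lemma moved_itv f z : f z != z -> exists a b,
  [/\ 0 < a, a <= z, a < b, b < 1 & forall y, a < y < b -> f y != y].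
Proof.
move=> fz.
have z0 : 0 < z by rewrite ltNge; apply: contraNN fz => ?; rewrite thompson_out //; left.
have z1 : z < 1 by rewrite ltNge; apply: contraNN fz => ?; rewrite thompson_out //; right.
case: (ltgtP (f z) z) fz => // h _.
  exists z, ((f^-1)%g z); rewrite lexx -tltV h thompson_lt1 //; split=> // y.
  by rewrite -tltV => /andP[zy fyz]; rewrite lt_eqF // (lt_trans fyz).
exists ((f^-1)%g z), z; rewrite -tgeV (ltW h) -tgtV h thompson_gt0 //; split=> // y.
by rewrite -tgtV => /andP[zfy yz]; rewrite gt_eqF // (lt_trans yz).
Qed.

Lemma half_bump : exists f : thompson R,
  (forall x, x <= 1 / 2 -> f x = x) /\ (forall x, 1 / 2 < x < 1 -> x < f x).
Proof.
have d2 : dyadic (1 / 2 : R) by exists 1, 1%N; rewrite expr1.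
have d8 : dyadic (1 / 8 : R).
  by exists 1, 3%N; rewrite -natrX.
have [|||f [f1 f2 _ _]] := thompson_bump d2 d8; [lra|lra|lra|].
exists (f^-1)%g; split=> x hx; first by apply: tfixV; apply: f1; left.
by rewrite -tltV f2 //; lra.
Qed.

End CompactSupport.

Section Extension.
Variable R : realType.
Implicit Types (f g h : thompson R) (a b d x y : R).

Lemma slope_at0 a (k : int) : 0 < a ->
  exists2 f : thompson R, supp_in 0 a f & germ 1 f 0 (2 ^ k).
Proof.
move=> a0; have [n dn] : exists n, 2 ^- n < Num.min a 1 / 4.
  by apply: exp2_small; rewrite divr_gt0 // lt_min a0 ltr01.
set d : R := 2 ^- n in dn; have d0 : 0 < d by rewrite exp2_gt0.
have dd : dyadic d by apply: dyadic_exp.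
clearbody d.
have [d1 d2] : 4 * d < a /\ 4 * d < 1.
  by move: dn; rewrite ltr_pdivlMr // lt_min => /andP[? ?]; split; lra.
have [||f [f1 _ f2 _]] := thompson_bump (dyadic0 R) dd d0; [by []|lra|].
have fg : germ 1 f 0 (2^-1).
  exists (2 * d) => [|t /andP[t0 td]]; first by lra.
  by rewrite !mul1r !add0r f2 ?subr0 ?add0r //; apply/andP; split; lra.
have fS : supp_in 0 a f.
  by move=> x hx; apply: f1; rewrite add0r; case: hx => ?; [left | right]; lra.
have [|g gS gk] := germ_pow _ fS fg (- k); first by rewrite invr_gt0.
by exists g => //; rewrite exprz_inv opprK in gk.
Qed.

Lemma slope_at1 b (k : int) : b < 1 ->
  exists2 f : thompson R, supp_in b 1 f & germ (-1) f 1 (2 ^ k).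
Proof.
move=> b1; have [n dn] : exists n, 2 ^- n < Num.min (1 - b) 1 / 4.
  by apply: exp2_small; rewrite divr_gt0 // lt_min subr_gt0 b1 ltr01.
set d : R := 2 ^- n in dn; have d0 : 0 < d by rewrite exp2_gt0.
have dd : dyadic d by apply: dyadic_exp.
clearbody d.
have [d1 d2] : 4 * d < 1 - b /\ 4 * d < 1.
  by move: dn; rewrite ltr_pdivlMr // lt_min => /andP[? ?]; split; lra.
have d4 : dyadic (1 - 4 * d).
  have -> : 1 - 4 * d = 1 + 2 ^ 2 * (0 - d) by rewrite -exprnP; ring.
  by apply: dyadic_lin; [exact: dyadic1|exact: dyadic0|exact: dd].
have [||f [f1 _ _ f2]] := thompson_bump d4 dd d0; [lra|lra|].
rewrite subrK in f1 f2.
have fg : germ (-1) f 1 2.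
  exists d => // t /andP[t0 td].
  by rewrite f2; [ring | apply/andP; split; lra].
have fS : supp_in b 1 f.
  by move=> x hx; apply: f1; case: hx => ?; [left | right]; lra.
have two0 : 0 < (2 : R) by [].
by have [g gS gk] := germ_pow two0 fS fg k; exists g.
Qed.

(** Correct f near 0 and 1 by powers of bumps with the inverse slopes. *)
Lemma compact_extension f a b : 0 < a -> b < 1 ->
  exists2 e, compact_supp e & forall x, a <= x <= b -> e x = f x.
Proof.
move=> a0 b1; have [k [j [f0 f1]]] := end_germs f.
pose a' := Num.min a (1 / 2); pose b' := Num.max b (1 / 2).
have [ea ea2] : a' <= a /\ a' <= 1 / 2 by rewrite !ge_min !lexx orbT.
have [eb eb2] : b <= b' /\ 1 / 2 <= b' by rewrite !le_max !lexx orbT.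
have a'0 : 0 < a' by rewrite lt_min a0; lra.
have b'1 : b' < 1 by rewrite gt_max b1; lra.
have [g gS g0] := slope_at0 (- k) a'0; have [h hS h1] := slope_at1 (- j) b'1.
exists (g * (h * f))%g; last first.
  move=> x /andP[ax xb]; have gx : g x = x by apply: gS; right; lra.
  by rewrite !tmulE gx hS //; left; lra.
have k0 (i : int) : 0 < (2 : R) ^ i by rewrite exprz_gt0.
have inv2 (i : int) : 2 ^ (- i) * 2 ^ i = 1 :> R.
  by rewrite -expfzDr ?pnatr_eq0 // addNr expr0z.
have gR : germ (-1) g 1 1.
  by exists (1 / 2) => [|t /andP[t0 te]]; [lra | rewrite gS; [ring | right; lra]].
have hL : germ 1 h 0 1.
  by exists (1 / 2) => [|t /andP[t0 te]]; [lra | rewrite hS; [ring | left; lra]].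
apply: compact_supp_germs.
  by have := germM (k0 _) g0 (germM ltr01 hL f0); rewrite mul1r inv2.
by have := germM ltr01 gR (germM (k0 _) h1 f1); rewrite mul1r inv2.
Qed.

End Extension.

(** * Every element of F agrees with H near each point *)

Section PiecewiseH.
Variables (R : realType) (H : set (thompson R)).
Hypothesis sH : subgroup H.
Hypothesis H_piecewise : forall f, piecewise H f 0 1.
Hypothesis H_derived : forall f : thompson R, exists h c, [/\ H h, derived (thompson R) c & f = (h * c)%g].
Implicit Types (f g h n r : thompson R) (a b d e t x y z : R).

Definition locally_H f x : Prop := exists2 h, H h & agree f h x.

(** One-sided agreement is immediate, also at the points of division. *)
Lemma H_side (s : R) f x : s = 1 \/ s = -1 -> 0 < x < 1 ->
  exists2 h, H h & exists2 e, 0 < e & forall t, 0 <= t <= e -> f (x + s * t) = h (x + s * t).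
Proof.
move=> s1 /andP[x0 x1]; have [ps [_ psP]] := H_piecewise f.
have [e e0 eP] := list_gap ps x.
pose r := Num.min e (Num.min x (1 - x)).
have r0 : 0 < r by rewrite !lt_min e0 x0 subr_gt0.
have [r1 r2 r3] : [/\ r <= e, r <= x & r <= 1 - x].
  by rewrite /r !ge_min !lexx !orbT.
case: s1 => ->.
  have [||||h Hh hf] := psP x (x + r); [lra|lra|lra| |].
    move=> p /eP pe; apply/negP => /andP[xp px].
    by have := pe (negbT (gt_eqF xp)); rewrite gtr0_norm ?subr_gt0 //; lra.
  by exists h => //; exists r => // t /andP[t0 tr]; rewrite hf //; apply/andP; split; lra.
have [||||h Hh hf] := psP (x - r) x; [lra|lra|lra| |].
  move=> p /eP pe; apply/negP => /andP[xp px].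
  by have := pe (negbT (lt_eqF px)); rewrite ltr0_norm ?subr_lt0 //; lra.
by exists h => //; exists r => // t /andP[t0 tr]; rewrite hf //; apply/andP; split; lra.
Qed.

Lemma H_transfer f x : 0 < x < 1 -> exists2 h, H h & h x = f x.
Proof.
move=> x01; have [h Hh [e e0 hE]] := H_side f (or_introl erefl) x01.
exists h => //; have := hE 0; rewrite mulr0 addr0 => -> //.
by rewrite lexx ltW.
Qed.

(** H has the same orbits in (0, 1) as F. *)
Lemma H_dense a b x : 0 < x < 1 -> 0 <= a -> a < b -> b <= 1 ->
  exists2 h, H h & a < h x < b.
Proof.
move=> x01 a0 ab b1; have [f fab] := orbit_dense x01 a0 ab b1.
by have [h Hh hE] := H_transfer f x01; exists h => //; rewrite hE.
Qed.

Lemma locally_H_off f : exists ps : seq R, (forall d, d \in ps -> dyadic d) /\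
  forall x, 0 < x < 1 -> x \notin ps -> locally_H f x.
Proof.
have [ps [dps psP]] := H_piecewise f; exists ps; split=> // x /andP[x0 x1] xps.
have [e e0 eP] := list_gap ps x.
pose r := Num.min e (Num.min x (1 - x)) / 2.
have r0 : 0 < r by rewrite divr_gt0 // !lt_min e0 x0 subr_gt0.
have [r1 r2 r3] : [/\ r < e, r < x & r < 1 - x].
  by rewrite /r; split; rewrite ltr_pdivrMr // !gt_min; apply/or3P;
    [apply: Or31|apply: Or32|apply: Or33]; lra.
have [||||h Hh hf] := psP (x - r) (x + r); [lra|lra|lra| |]; last first.
  by exists h => //; exists r.
move=> p pps; apply/negP => /andP[xp px].
have px' : p != x by apply: contraNneq xps => <-.
have := eP p pps px'; case: ler0P; lra.
Qed.

Lemma locally_H_id h x : H h -> locally_H h x.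
Proof. by move=> Hh; exists h => //; apply: agree_refl. Qed.

Lemma locally_HM f g x : locally_H f x -> locally_H g (f x) -> locally_H (f * g)%g x.
Proof.
move=> [h Hh fh] [h' Hh' gh]; exists (h * h')%g; first exact: subgroupM.
exact: agreeM.
Qed.

Lemma locally_HV f x : locally_H f x -> locally_H f^-1%g (f x).
Proof.
by move=> [h Hh fh]; exists (h^-1)%g; [apply: subgroupV | apply: agreeV].
Qed.

Lemma locally_H_agree f g x : agree f g x -> locally_H g x -> locally_H f x.
Proof.
move=> [e e0 fg] [h Hh [e' e'0 gh]]; exists h => //.
pose r := Num.min e e'.
have [r1 r2] : r <= e /\ r <= e' by rewrite /r !ge_min !lexx !orbT.
exists r => [|y /andP[xy yx]]; first by rewrite lt_min e0.
by rewrite fg ?gh //; apply/andP; split; lra.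
Qed.

(** The homomorphism from F to the pairs of slopes modulo those of H.  The
quotient group is not formed; [cong] is congruence modulo [H_germs], and products
run over finite lists containing all points with a nontrivial class. *)
Section Cocycle.
Implicit Types (s u v : seq R) (p q l : R * R).
Variable alpha : R.
Hypothesis alpha01 : 0 < alpha < 1.

Let X : set R := [set x | exists2 h, H h & h alpha = x].

Lemma orbit_open x : X x -> 0 < x < 1.
Proof. by case=> h _ <-; rewrite thompson01. Qed.

Lemma orbit_stable f x : X x -> X (f x).
Proof.
case=> h Hh <-; have [h' Hh' h'E] := H_transfer (h * f)%g alpha01.
by exists h'.
Qed.

Definition germ_pair g p : Prop :=
  [/\ 0 < p.1, 0 < p.2, germ 1 g alpha p.1 & germ (-1) g alpha p.2].

Lemma germ_pair_ex g : g alpha = alpha -> exists p, germ_pair g p.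
Proof.
move=> ga; have /andP[a0 a1] := alpha01.
have [|k kP] := @germ_ex R 1 g alpha _ ga; first by left; rewrite a1 ltW.
have [|j jP] := @germ_ex R (-1) g alpha _ ga; first by right; rewrite a0 ltW.
by exists (2 ^ k, 2 ^ j); split; rewrite ?exprz_gt0.
Qed.

Lemma germ_pairM g h p q : germ_pair g p -> germ_pair h q -> germ_pair (g * h)%g (p * q).
Proof.
by case=> p1 p2 gp1 gp2 [q1 q2 hq1 hq2]; split; rewrite ?mulr_gt0 //; apply: germM.
Qed.

Lemma germ_pair1 : germ_pair 1%g 1.
Proof. by split; [exact: ltr01|exact: ltr01|exact: germ1|exact: germ1]. Qed.

Lemma germ_pairV g p : germ_pair g p -> germ_pair g^-1%g (p.1^-1, p.2^-1).
Proof. by case=> p1 p2 gp1 gp2; split; rewrite ?invr_gt0 //; apply: germV. Qed.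

Lemma germ_pair_fun g p q : germ_pair g p -> germ_pair g q -> p = q.
Proof.
case: p q => [p1 p2] [q1 q2] [_ _ /= g1 g2] [_ _ /= g1' g2'].
congr pair; first exact: germ_fun (oner_neq0 _) g1 g1'.
by apply: germ_fun g2 g2'; rewrite oppr_eq0 oner_eq0.
Qed.

Lemma agree_germ_pair g h p : agree g h alpha -> germ_pair g p -> germ_pair h p.
Proof.
move=> gh [p1 p2 g1 g2]; split=> //; first by apply: agree_germ gh g1; left.
by apply: agree_germ gh g2; right.
Qed.

Lemma germ_pair_agree g h p : germ_pair g p -> germ_pair h p -> agree g h alpha.
Proof. by case=> _ _ g1 g2 [_ _ h1 h2]; apply: agree_germs g1 h1 g2 h2. Qed.

Definition H_germs p : Prop := exists2 h, H h & germ_pair h p.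

Lemma H_germs1 : H_germs 1.
Proof. by exists 1%g; [apply: subgroup1 | apply: germ_pair1]. Qed.

Lemma H_germsM p q : H_germs p -> H_germs q -> H_germs (p * q).
Proof.
case=> g Hg gp [h Hh hq]; exists (g * h)%g; first exact: subgroupM.
exact: germ_pairM.
Qed.

Lemma H_germsV p : H_germs p -> exists2 q, H_germs q & p * q = 1.
Proof.
case=> h Hh hp; have hV := germ_pairV hp.
exists (p.1^-1, p.2^-1); first by exists (h^-1)%g => //; apply: subgroupV.
case: hp => p1 p2 _ _; case: p p1 p2 {hV} => a b /= a0 b0.
by congr pair => /=; rewrite divff // gt_eqF.
Qed.

Definition cong p q : Prop := exists2 l, H_germs l & p = q * l.

Lemma cong_refl p : cong p p.
Proof. by exists 1; [apply: H_germs1 | rewrite mulr1]. Qed.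

Lemma cong_sym p q : cong p q -> cong q p.
Proof.
case=> l Ll ->; have [l' Ll' ll'] := H_germsV Ll; exists l' => //.
by rewrite -mulrA ll' mulr1.
Qed.

Lemma cong_trans p q l : cong p q -> cong q l -> cong p l.
Proof.
case=> a La -> [b Lb ->]; exists (b * a); first exact: H_germsM.
by rewrite mulrA.
Qed.

Lemma congM p q p' q' : cong p q -> cong p' q' -> cong (p * p') (q * q').
Proof.
case=> l Ll -> [l' Ll' ->]; exists (l * l'); first exact: H_germsM.
by rewrite mulrACA.
Qed.

Lemma cong1 p : cong p 1 <-> H_germs p.
Proof. by split=> [[l Ll ->]|Lp]; [rewrite mul1r | exists p; rewrite ?mul1r]. Qed.

Lemma transversal_ex : exists k : R -> thompson R,
  forall x, X x -> H (k x) /\ k x alpha = x.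
Proof.
have /choice[k kP] x : exists h, X x -> H h /\ h alpha = x.
  have [[h Hh hx]|nX] := pselect (X x); first by exists h.
  by exists 1%g.
by exists k.
Qed.

Variable k : R -> thompson R.
Hypothesis kP : forall x, X x -> H (k x) /\ k x alpha = x.

(** The germ of f at x, brought back to alpha along elements of H. *)
Definition pullback f x : thompson R := (k x * f * (k (f x))^-1)%g.

Lemma pullback_fix f x : X x -> pullback f x alpha = alpha.
Proof.
move=> Xx; rewrite /pullback !tmulE (kP Xx).2; apply: (canLR (tinvK _)).
by rewrite (kP (orbit_stable f Xx)).2.
Qed.

Lemma slopes_ex : exists slopes : thompson R -> R -> R * R,
  forall f x, X x -> germ_pair (pullback f x) (slopes f x).
Proof.
have /choice[slopes slopesP] (fx : thompson R * R) : exists p,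
    X fx.2 -> germ_pair (pullback fx.1 fx.2) p.
  have [Xx|nX] := pselect (X fx.2); last by exists 1.
  by have [p pP] := germ_pair_ex (pullback_fix fx.1 Xx); exists p.
by exists (fun f x => slopes (f, x)) => f x; apply: (slopesP (f, x)).
Qed.

Variable slopes : thompson R -> R -> R * R.
Hypothesis slopesP : forall f x, X x -> germ_pair (pullback f x) (slopes f x).

Lemma slopesM f g x : X x -> slopes (f * g)%g x = slopes f x * slopes g (f x).
Proof.
move=> Xx; apply: (germ_pair_fun (slopesP (f * g)%g Xx)).
have -> : pullback (f * g)%g x = (pullback f x * pullback g (f x))%g.
  by rewrite /pullback tmulE !mulgA mulgVK.
exact: germ_pairM (slopesP f Xx) (slopesP g (orbit_stable f Xx)).
Qed.

Lemma slopes_locally_H f x : X x -> locally_H f x -> H_germs (slopes f x).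
Proof.
move=> Xx fH; have [Hk kx] := kP Xx; have [Hk' kx'] := kP (orbit_stable f Xx).
have [h Hh ph] : locally_H (pullback f x) alpha.
  apply: locally_HM; last first.
    by rewrite tmulE kx; have := locally_HV (locally_H_id alpha Hk'); rewrite kx'.
  by apply: locally_HM; [apply: locally_H_id | rewrite kx].
by exists h => //; apply: agree_germ_pair ph (slopesP f Xx).
Qed.

Definition total f (s : seq R) : R * R := \prod_(x <- s) slopes f x.

(** The list s may be longer than necessary: extra points only change [total] by
an element of [H_germs]. *)
Definition exceptional f (s : seq R) : Prop :=
  [/\ uniq s, forall x, x \in s -> X x &
      forall x, X x -> x \notin s -> locally_H f x].

Lemma exceptional_ex f : exists s, exceptional f s.
Proof.
have [ps [_ psP]] := locally_H_off f.
exists [seq x <- undup ps | `[< X x >]]; split.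
- by rewrite filter_uniq // undup_uniq.
- by move=> x; rewrite mem_filter => /andP[/asboolP].
- move=> x Xx; rewrite mem_filter mem_undup (introT (asboolP _) Xx) /=.
  exact: psP (orbit_open Xx).
Qed.

Lemma exceptional_sub f s u : exceptional f s -> uniq u ->
  (forall x, x \in u -> X x) -> {subset s <= u} -> exceptional f u.
Proof.
move=> [us Xs sP] uu Xu su; split=> // x Xx xu; apply: sP => //.
by apply: contra xu => /su.
Qed.

Lemma total_sub f s u : exceptional f s -> uniq u ->
  (forall x, x \in u -> X x) -> {subset s <= u} -> cong (total f u) (total f s).
Proof.
move=> [us Xs sP] uu Xu su; rewrite /total (bigID (mem s)) /=.
rewrite -big_filter (perm_big s); last first.
  apply: uniq_perm; rewrite ?filter_uniq // => x; rewrite mem_filter.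
  by apply/andP/idP => [[]//|xs]; split=> //; apply: su.
exists (\prod_(x <- u | x \notin s) slopes f x) => //.
rewrite big_seq_cond; elim/big_ind: _ => [||x /andP[xu xs]].
- exact: H_germs1.
- exact: H_germsM.
- by apply: slopes_locally_H; [apply: Xu | apply: sP => //; apply: Xu].
Qed.

Lemma total_cong f s s' : exceptional f s -> exceptional f s' ->
  cong (total f s) (total f s').
Proof.
move=> es es'; pose u := undup (s ++ s').
have Xu x : x \in u -> X x.
  rewrite mem_undup mem_cat.
  by case: es es' => _ Xs _ [_ Xs' _] /orP[/Xs|/Xs'].
have su : {subset s <= u} by move=> x xs; rewrite mem_undup mem_cat xs.
have su' : {subset s' <= u} by move=> x xs; rewrite mem_undup mem_cat xs orbT.
apply: cong_trans (cong_sym (total_sub es (undup_uniq _) Xu su)) _.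
exact: total_sub es' (undup_uniq _) Xu su'.
Qed.

Lemma totalM f g s : (forall x, x \in s -> X x) ->
  total (f * g)%g s = total f s * total g (map f s).
Proof.
move=> Xs; rewrite /total big_map -big_split /=.
by apply: eq_big_seq => x /Xs; apply: slopesM.
Qed.

(** The kernel of the homomorphism. *)
Definition negligible f : Prop := exists2 s, exceptional f s & H_germs (total f s).

Lemma negligible_total f s : negligible f -> exceptional f s -> H_germs (total f s).
Proof.
case=> s' es' Hs' es; apply/cong1; apply: cong_trans (total_cong es es') _.
exact/cong1.
Qed.

(** Over a common list v the totals of f over v and of g over f(v) multiply
exactly, by the cocycle identity [slopesM]. *)
Lemma totals_mul f g s s' u : exceptional f s -> exceptional g s' ->
  exceptional (f * g)%g u -> cong (total (f * g)%g u) (total f s * total g s').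
Proof.
move=> es es' eu; pose v := undup (s ++ map (f^-1)%g s').
have Xv x : x \in v -> X x.
  case: es es' => _ Xs _ [_ Xs' _].
  rewrite mem_undup mem_cat => /orP[/Xs//|/mapP[y /Xs' Xy ->]].
  exact: orbit_stable.
have sv : {subset s <= v} by move=> x xs; rewrite mem_undup mem_cat xs.
have sv' : {subset s' <= map f v}.
  move=> x xs; apply/mapP; exists ((f^-1)%g x); last by rewrite tinvKV.
  by rewrite mem_undup mem_cat (map_f _ xs) orbT.
have uv : uniq v by rewrite undup_uniq.
have uv' : uniq (map f v) by rewrite map_inj_uniq //; apply: tinj.
have Xv' x : x \in map f v -> X x by move=> /mapP[y /Xv Xy ->]; apply: orbit_stable.
have efv := exceptional_sub es uv Xv sv.
have egv := exceptional_sub es' uv' Xv' sv'.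
have ev : exceptional (f * g)%g v.
  split=> // x Xx xv; apply: locally_HM; first by case: efv => _ _; apply.
  case: egv => _ _; apply; first exact: orbit_stable.
  by rewrite mem_map //; apply: tinj.
apply: cong_trans (total_cong eu ev) _; rewrite totalM //.
by apply: congM; [apply: total_sub | apply: total_sub].
Qed.

Lemma negligibleM f g : negligible f -> negligible g -> negligible (f * g)%g.
Proof.
case=> s es Hs [s' es' Hs']; have [u eu] := exceptional_ex (f * g)%g.
exists u => //; have [l Ll ->] := totals_mul es es' eu.
by do !apply: H_germsM.
Qed.

Lemma negligible_H h : H h -> negligible h.
Proof.
move=> Hh; exists [::]; last by rewrite /total big_nil; apply: H_germs1.
by split=> // x _ _; apply: locally_H_id.
Qed.

Lemma total_inv f s s' : exceptional f s -> exceptional f^-1%g s' ->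
  cong (total f^-1%g s' * total f s) 1.
Proof.
move=> es es'; have [u eu ] := exceptional_ex (f^-1 * f)%g.
apply: cong_trans (cong_sym (totals_mul es' es eu)) _; apply/cong1.
by apply: negligible_total eu; rewrite mulVg; apply: negligible_H; apply: subgroup1.
Qed.

Lemma negligibleV f : negligible f -> negligible f^-1%g.
Proof.
case=> s es Hs; have [s' es'] := exceptional_ex (f^-1)%g; exists s' => //.
have [q Hq sq] := H_germsV Hs.
apply/cong1; have := congM (total_inv es es') (proj2 (cong1 q) Hq).
by rewrite -mulrA sq mulr1 mulr1.
Qed.

(** The values are in a commutative group. *)
Lemma negligibleR f g : negligible [~ f, g]%g.
Proof.
have [s es] := exceptional_ex f; have [t et] := exceptional_ex g.
have [s' es'] := exceptional_ex (f^-1)%g; have [t' et'] := exceptional_ex (g^-1)%g.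
have [u eu] := exceptional_ex (f * g)%g.
have [v ev] := exceptional_ex (g^-1 * (f * g))%g.
have [w ew] := exceptional_ex [~ f, g]%g; exists w => //; apply/cong1.
apply: cong_trans (totals_mul es' ev ew) _.
have h := congM (cong_refl (total (f^-1)%g s')) (cong_trans (totals_mul et' eu ev)
  (congM (cong_refl _) (totals_mul es et eu))).
apply: cong_trans h _.
have -> : total f^-1%g s' * (total g^-1%g t' * (total f s * total g t)) =
  (total f^-1%g s' * total f s) * (total g^-1%g t' * total g t).
  by rewrite [RHS]mulrACA mulrA.
by have := congM (total_inv es es') (total_inv et et'); rewrite mulr1.
Qed.

(** A homomorphism to an abelian group that is trivial on H is trivial on
H[F,F] = F. *)
Lemma all_negligible f : negligible f.
Proof.
have [h [c [Hh Dc ->]]] := H_derived f; apply: negligibleM.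
  exact: negligible_H.
move: c Dc; apply: smallest_sub.
  apply: subgroupP; [|exact: negligibleM|exact: negligibleV].
  by apply: negligible_H; apply: subgroup1.
by move=> _ [f' _ [g' _ <-]]; apply: negligibleR.
Qed.

(** Only alpha contributes to the total of f, and the total is trivial. *)
Lemma locally_H_at f : f alpha = alpha ->
  (forall x, X x -> x != alpha -> locally_H f x) -> locally_H f alpha.
Proof.
move=> fa fX; have Xa : X alpha by exists 1%g => //; apply: subgroup1.
have ef : exceptional f [:: alpha].
  by split=> // x; rewrite inE; [move/eqP-> | apply: fX].
have [h Hh hP] : H_germs (slopes f alpha).
  by have := negligible_total (all_negligible f) ef; rewrite /total big_seq1.
have [Hk kx] := kP Xa.
have ph := germ_pair_agree (slopesP f Xa) hP.
have -> : f = ((k alpha)^-1 * (pullback f alpha * k alpha))%g.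
  by rewrite /pullback fa mulgVK mulKg.
apply: locally_HM; first by apply: locally_H_id; apply: subgroupV.
have -> : ((k alpha)^-1)%g alpha = alpha by apply: tfixV.
apply: locally_HM; last exact: locally_H_id.
by exists h.
Qed.

End Cocycle.

(** At a point x of division let h1 and h2 in H agree with f on the right and on
the left.  Dividing by h2 leaves the map that is the identity before x and
h1 * h2^-1 after it; away from x it agrees with elements of H, so
[locally_H_at] applies. *)
Lemma locally_H_everywhere f x : 0 < x < 1 -> locally_H f x.
Proof.
move=> x01; have [ps [dps psP]] := locally_H_off f.
have [xps|] := boolP (x \in ps); last exact: psP.
have [h1 H1 [e1 e10 f1]] := H_side f (or_introl erefl) x01.
have [h2 H2 [e2 e20 f2]] := H_side f (or_intror erefl) x01.
have e1x : f x = h1 x by have := f1 0; rewrite mulr0 addr0 lexx ltW //; apply.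
have e2x : f x = h2 x by have := f2 0; rewrite mulr0 addr0 lexx ltW //; apply.
pose h : thompson R := (h1 * h2^-1)%g.
have Hh : H h by apply: subgroupM => //; apply: subgroupV.
have hx : h x = x by rewrite /h tmulE -e1x e2x tinvK.
have [||f' [f'l f'r]] := @thompson_glue R 1%g h x (dps x xps).
- by case/andP: x01 => *; rewrite !ltW.
- by rewrite hx.
have f'x : f' x = x by rewrite f'l.
have f'H : locally_H f' x.
  have [k kP] := transversal_ex x; have [slopes slopesP] := slopes_ex x01 kP.
  apply: (locally_H_at x01 kP slopesP) => // y Xy yx.
  case: (ltgtP x y) yx => // xy _.
    apply: (locally_H_agree (g := h)); last exact: locally_H_id.
    by exists (y - x) => [|z /andP[yz zy]]; [rewrite subr_gt0 | apply: f'r; lra].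
  apply: (locally_H_agree (g := 1%g)); last by apply: locally_H_id; apply: subgroup1.
  by exists (x - y) => [|z /andP[yz zy]]; [rewrite subr_gt0 | apply: f'l; lra].
apply: (locally_H_agree (g := (f' * h2)%g)); last first.
  by apply: locally_HM => //; apply: locally_H_id.
pose r := Num.min e1 e2.
have [r1 r2] : r <= e1 /\ r <= e2 by rewrite /r !ge_min !lexx !orbT.
exists r => [|y /andP[xy yx]]; first by rewrite lt_min e10.
rewrite tmulE; case: (leP x y) => h0.
  rewrite f'r // /h tmulE tinvKV.
  have -> : y = x + 1 * (y - x) by ring.
  by apply: f1; apply/andP; split; lra.
rewrite f'l; last exact: ltW.
rewrite toneE; have -> : y = x + -1 * (x - y) by ring.
by apply: f2; apply/andP; split; lra.
Qed.

Implicit Types s u v : R.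

(** * Elements of H of small support *)

Lemma H_compact f : exists h c, [/\ H h, compact_supp c & f = (h * c)%g].
Proof.
have [h [c [Hh Dc ->]]] := H_derived f.
by exists h, c; split=> //; apply: derived_compact_supp.
Qed.

Definition H_compact_supp : set (thompson R) := H `&` @compact_supp R.

Lemma H_compact_supp_subgroup : subgroup H_compact_supp.
Proof.
have sC := compact_supp_subgroup R.
apply: subgroupP; first by split; apply: subgroup1.
  by move=> f g [? ?] [? ?]; split; apply: subgroupM.
by move=> f [? ?]; split; apply: subgroupV.
Qed.

(** A moved point lies in an interval of moved points, which meets every orbit of
H. *)
Lemma fix_orbit f x : 0 < x < 1 -> (forall h, H h -> f (h x) = h x) -> forall z, f z = z.
Proof.
move=> x01 fH z; apply/eqP; apply: contraT => /moved_itv[a [b [a0 _ ab b1 mv]]].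
have [h Hh /mv/eqP[]] := H_dense x01 (ltW a0) ab (ltW b1).
exact: fH.
Qed.

(** Take h in H that agrees near 1/2 with a map that fixes 1/2 but is not the
identity next to it.  If h commuted with H it would fix the orbit of 1/2, so some
commutator of h is nontrivial, and commutators are the identity near 0 and 1. *)
Lemma H_compact_supp_nontrivial : exists n z, H_compact_supp n /\ n z != z.
Proof.
have [f [f1 f2]] := half_bump R.
have x01 : 0 < (1 / 2 : R) < 1 by apply/andP; split; lra.
have [h Hh [e e0 fh]] := locally_H_everywhere f x01.
have hx : h (1 / 2) = 1 / 2 by rewrite -fh ?f1 //; apply/andP; split; lra.
apply: contrapT => no.
have hid : forall z, h z = z.
  apply: (fix_orbit x01) => g Hg.
  have comm1 : [~ h, g]%g = 1%g.
    apply: thompson_eqP => z; rewrite toneE; apply/eqP; apply: contraT => mz.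
    case: no; exists [~ h, g]%g, z; split=> //; split; first exact: subgroupR.
    apply: derived_compact_supp; apply: sub_gen_smallest.
    by exists h => //; exists g.
  have hg : (h * g)%g = (g * h)%g by rewrite commgC comm1 mulg1.
  by rewrite -tmulE -hg tmulE hx.
pose y : R := 1 / 2 + Num.min e (1 / 4).
have [y1 y2 y3] : [/\ 1 / 2 < y, y <= 1 / 2 + e & y < 1].
  have h0 : 0 < Num.min e (1 / 4) by rewrite lt_min e0; lra.
  have [h1 h2] : Num.min e (1 / 4) <= e /\ Num.min e (1 / 4) <= 1 / 4.
    by rewrite !ge_min !lexx orbT.
  by rewrite /y; split; lra.
have := f2 y; rewrite y1 y3 => /(_ isT); rewrite fh ?hid ?ltxx //.
by apply/andP; split; lra.
Qed.

Lemma H_compact_suppJ n h : H_compact_supp n -> H h -> H_compact_supp (n ^ h)%g.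
Proof. by case=> Hn cn Hh; split; [apply: subgroupJ | apply: compact_suppJ]. Qed.

Lemma H_compact_supp_moves x : 0 < x < 1 -> exists2 n, H_compact_supp n & n x != x.
Proof.
move=> x01; have [n [z [Hn /moved_itv[a [b [a0 _ ab b1 mv]]]]]] := H_compact_supp_nontrivial.
have [h Hh /mv hx] := H_dense x01 (ltW a0) ab (ltW b1).
exists (n ^ h^-1)%g; first by apply: H_compact_suppJ => //; apply: subgroupV.
by rewrite tconjE invgK; apply: contra hx => /eqP E; rewrite -{2}E tinvKV.
Qed.

Definition H_right x : set (thompson R) :=
  [set h | H h /\ exists2 b, b < 1 & supp_in x b h].

Lemma H_right_subgroup x : subgroup (H_right x).
Proof.
apply: subgroupP.
- by split; [apply: subgroup1 | exists 0; [exact: ltr01 | exact: supp_in1]].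
- move=> f g [Hf [b b1 fS]] [Hg [b' b'1 gS]]; split; first exact: subgroupM.
  exists (Num.max b b'); first by rewrite gt_max b1.
  by apply: supp_inM; [apply: supp_in_sub fS | apply: supp_in_sub gS];
    rewrite ?le_max lexx ?orbT.
- move=> f [Hf [b b1 fS]]; split; first exact: subgroupV.
  by exists b => //; apply: supp_inV.
Qed.

Lemma H_right_sub x y r : x <= y -> H_right y r -> H_right x r.
Proof.
move=> xy [Hr [b b1 rS]]; split=> //; exists b => //.
exact: supp_in_sub rS.
Qed.

Lemma H_rightJ x r h : H_right x r -> H h -> H_right (h x) (r ^ h)%g.
Proof.
move=> [Hr [b b1 rS]] Hh; split; first exact: subgroupJ.
by exists (h b); [apply: thompson_lt1 | apply: supp_inJ].
Qed.

(** There are no such points ([not_stuck]). *)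
Definition stuck x : set R :=
  [set s | x < s < 1 /\ forall r, H_right x r -> r s = s].

Lemma stuckJ x s h : H h -> stuck x s -> stuck (h x) (h s).
Proof.
move=> Hh [/andP[xs s1] sP]; split; first by rewrite thompson_lt xs thompson_lt1.
move=> r rx; have := sP (r ^ h^-1)%g; rewrite tconjE invgK => E.
apply: (canRL (tinvKV h)); apply: E.
have := H_rightJ rx (subgroupV sH Hh); rewrite tinvK; exact.
Qed.

(** Such an element exists in F, and H contains one with the same germs at 0 and
1. *)
Lemma end_push : exists2 h, H h & exists e t,
  [/\ 0 < e, forall y, y <= e -> h y = y, 0 < t < 1 & forall y, t <= y < 1 -> y < h y].
Proof.
have [f [f1 f2]] := half_bump R.
have [h [c [Hh [a a0 [b b1 cS]] fE]]] := H_compact f.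
have hE y : h y = (c^-1)%g (f y) by rewrite fE tmulE tinvK.
have cV := supp_inV cS.
exists h => //; exists (Num.min a (1 / 2)), (Num.max b (3 / 4)).
have [m1 m2] : Num.min a (1 / 2) <= a /\ Num.min a (1 / 2) <= 1 / 2.
  by rewrite !ge_min !lexx orbT.
have [m3 m4] : b <= Num.max b (3 / 4) /\ 3 / 4 <= Num.max b (3 / 4).
  by rewrite !le_max !lexx orbT.
split.
- by rewrite lt_min a0; lra.
- by move=> y ye; rewrite hE f1 ?cV //; [left|]; lra.
- by rewrite gt_max b1; apply/andP; split; lra.
- move=> y /andP[ty y1]; have yf : y < f y by apply: f2; apply/andP; split; lra.
  by rewrite hE cV //; right; lra.
Qed.

(** Let h be the element of [end_push].  It normalizes [H_right a] for small a, so
the set of stuck points beyond t is carried towards t by h^-1; its infimum m lies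
in [t, h t).  But a large enough n in N moves all of that interval, and it is in
[H_right a] for a small. *)
Lemma stuck_far : exists a t, [/\ 0 < a, a < 1, t < 1 & forall s, stuck a s -> s < t].
Proof.
have [h Hh [e [t [e0 he /andP[t0 t1] ht]]]] := end_push.
have [z /andP[tz zh]|n [Hn [a a0 [b b1 nS]]] nt] :=
    @orbit_above _ _ t (h t) H_compact_supp_subgroup.
  by apply: H_compact_supp_moves; have := thompson_lt1 h t1 => ?; apply/andP; split; lra.
pose w := Num.min (Num.min a e) (1 / 2).
have [w1 w2 w3] : [/\ w <= a, w <= e & w <= 1 / 2] by rewrite /w !ge_min !lexx !orbT.
have w0 : 0 < w by rewrite !lt_min a0 e0; lra.
exists w, t; split=> //; first by lra.
move=> s0 sw0; rewrite ltNge; apply/negP => ts0.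
pose S : set R := [set s | t <= s /\ stuck w s].
have iS : has_inf S by split; [exists s0 | exists t => s [? _]].
pose m := inf S.
have tm : t <= m by apply: lb_le_inf => [|s [? _]] //; exists s0.
have ms : m <= s0 by apply: ge_inf => //; case: iS.
have m1 : m < 1 by case: sw0 => /andP[_]; lra.
have rm r : H_right w r -> r m = m by move=> wr; apply: fix_inf => // s [_ [_]]; apply.
have wm : w < m.
  rewrite ltNge; apply/negP => mw.
  have := rm n; rewrite /H_right => E.
  have nm : n m = m.
    by apply: E; split=> //; exists b => //; apply: supp_in_sub nS.
  have : n t <= n m by rewrite thompson_le.
  have : t < h t by apply: ht; rewrite lexx.
  rewrite nm; have := nS t; have [ta|] := leP t a; last by lra.
  by move=> E'; rewrite E' in nt; [lra | left].
have hm : m < h m by apply: ht; rewrite tm.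
have hVm : (h^-1)%g m < t.
  rewrite ltNge; apply/negP => slopes.
  have : m <= (h^-1)%g m.
    apply: ge_inf; first by case: iS.
    have hw : (h^-1)%g w = w by apply/tfixV/he.
    split=> //; rewrite -[X in stuck X _]hw; apply: stuckJ; first exact: subgroupV.
    by split; first by rewrite wm.
  by rewrite -tleV; lra.
have nm : n m = m by apply: rm; split=> //; exists b => //; apply: supp_in_sub nS.
have : n t <= n m by rewrite thompson_le.
by rewrite -tgtV in hVm; lra.
Qed.

(** Move x below the point a of [stuck_far]. *)
Lemma stuck_bounded x : 0 < x < 1 -> exists2 b, b < 1 & forall s, stuck x s -> s <= b.
Proof.
move=> x01; have [a [t [a0 a1 t1 far]]] := stuck_far.
have [h Hh /andP[hx0 hxa]] := H_dense x01 (lexx 0) a0 (ltW a1).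
exists (Num.max ((h^-1)%g t) ((h^-1)%g a)); first by rewrite gt_max !thompson_lt1.
move=> s xs; rewrite le_max -!tleV; have [ha|ah] := leP (h s) a; first by rewrite orbT.
rewrite ltW //; apply: far; have [/andP[_ s1] sP] := stuckJ Hh xs.
split; first by rewrite ah.
by move=> r ar; apply: sP; apply: H_right_sub ar; apply: ltW.
Qed.

Definition stuck_sup x : R := sup (stuck x).

Lemma stuck_supP x : 0 < x < 1 -> stuck x !=set0 ->
  stuck x (stuck_sup x) /\ forall s, stuck x s -> s <= stuck_sup x.
Proof.
move=> x01 [s0 xs0]; have [b b1 bP] := stuck_bounded x01.
have sS : has_sup (stuck x) by split; [exists s0 | exists b].
have ub s : stuck x s -> s <= stuck_sup x by move=> xs; apply: ub_le_sup => //; case: sS.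
split=> //; split.
  have -> /= : x < stuck_sup x by case: xs0 (ub _ xs0) => /andP[]; lra.
  apply: le_lt_trans b1; apply: ge_sup => //; by exists s0.
by move=> r xr; apply: fix_sup => // s [_]; apply.
Qed.

Lemma stuck_sup_le x y : 0 < x -> x <= y -> y < 1 -> stuck x !=set0 -> stuck y !=set0 ->
  stuck_sup x <= stuck_sup y.
Proof.
move=> x0 xy y1 Sx Sy.
have [|[/andP[xs s1] sP] _] := stuck_supP _ Sx; first by rewrite x0; lra.
have [|[/andP[ys _] _] ub] := stuck_supP _ Sy; first by rewrite y1 andbT; lra.
case: (leP (stuck_sup x) y) => h; first by lra.
apply: ub; split; first by rewrite h.
by move=> r yr; apply: sP; apply: H_right_sub yr.
Qed.

Lemma stuck_supJ h x : H h -> 0 < x < 1 -> stuck x !=set0 -> stuck_sup (h x) = h (stuck_sup x).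
Proof.
move=> Hh x01 Sx; have [sx ub] := stuck_supP x01 Sx.
have hx01 : 0 < h x < 1 by rewrite thompson01.
have shx := stuckJ Hh sx.
have [shx' ub'] := stuck_supP hx01 (ex_intro _ _ shx).
apply/eqP; rewrite eq_le (ub' _ shx) andbT tgeV.
by have := stuckJ (subgroupV sH Hh) shx'; rewrite tinvK => /ub.
Qed.

(** If some point is stuck, [stuck_sup] is nondecreasing and commutes with H, so
its image is dense.  Then an element r of H that fixes [0, y] also fixes the
points [stuck_sup] (h x) = h ([stuck_sup] x) with h x <= y, and so all points up
to [stuck_sup y] > y.  With y the infimum m of the points moved by an element of
N this is absurd; moving m by H shows that m has stuck points too. *)
Lemma not_stuck x s : 0 < x -> ~ stuck x s.
Proof.
move=> x0 xs.
have x01 : 0 < x < 1 by case: xs => /andP[? ?] _; rewrite x0; lra.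
have rigid y r : 0 < y < 1 -> stuck y !=set0 -> H_right y r ->
    forall z, z < stuck_sup y -> r z = z.
  move=> y01 Sy ry z zs; apply/eqP; apply: contraT => /moved_itv[a [b [a0 az ab b1 mv]]].
  have Sx : stuck x !=set0 by exists s.
  have [[/andP[xS S1] _] _] := stuck_supP x01 Sx.
  have s01 : 0 < stuck_sup x < 1 by apply/andP; split; lra.
  have am : a < Num.min b (stuck_sup y) by rewrite lt_min ab; lra.
  have m1 : Num.min b (stuck_sup y) <= 1 by rewrite ge_min (ltW b1).
  (* a point of the image of stuck_sup among those moved by r *)
  have [h Hh /andP[ah]] := H_dense s01 (ltW a0) am m1.
  rewrite lt_min => /andP[hb hy].
  have hx01 : 0 < h x < 1 by rewrite thompson01.
  have Shx : stuck (h x) !=set0 by exists (h s); apply: stuckJ.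
  have hxy : h x <= y.
    rewrite leNgt; apply/negP => /ltW yh; move: hy; rewrite -stuck_supJ // ltNge.
    by case/andP: y01 => y0 _; case/andP: hx01 => _ ?; rewrite stuck_sup_le.
  have Hr : H r by case: ry.
  have rhx : r (h x) = h x by case: ry => _ [b' _ rS]; apply: rS; left.
  have /eqP[] : r (h (stuck_sup x)) != h (stuck_sup x) by apply: mv; rewrite ah.
  by rewrite -stuck_supJ // -stuck_supJ // rhx.
have [n [z [[Hn [a a0 [b b1 nS]]] nz]]] := H_compact_supp_nontrivial.
pose S : set R := [set y | n y != y].
have Sa y : S y -> a < y < b.
  move=> Sy; rewrite !ltNge; apply/andP; split; apply: contraNN Sy => h.
    by rewrite nS //; left.
  by rewrite nS //; right.
have iS : has_inf S by split; [exists z | exists a => y /Sa/andP[/ltW]].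
pose m := inf S.
have am : a <= m by apply: lb_le_inf => [|y /Sa/andP[/ltW]] //; exists z.
have mz : m <= z by apply: ge_inf => //; case: iS.
have zb : z < b by case/andP: (Sa z nz).
have m01 : 0 < m < 1 by apply/andP; split; lra.
have nm y : y < m -> n y = y.
  move=> ym; apply/eqP; apply: contraT => /(ge_inf iS.2).
  by rewrite leNgt ym.
have nm' : n m = m.
  apply/eqP; rewrite eq_le !leNgt; apply/andP; split; apply/negP => h.
    move: h; rewrite tgtV => h; have := nm _ h; rewrite tinvKV => E.
    by rewrite -E ltxx in h.
  by have := nm (n m) h => /(@tinj _ n) E; rewrite E ltxx in h.
(* H moves m between x and s; points in there have s as a stuck point *)
have [h Hh /andP[xhm hms]] : exists2 h, H h & x < h m < s.
  by case: (xs) => /andP[x_s s1] _; apply: H_dense m01 (ltW x0) x_s (ltW s1).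
have Shm : stuck (h m) !=set0.
  exists s; case: xs => /andP[_ s1] sP; split; first by rewrite hms.
  by move=> r hr; apply: sP; apply: H_right_sub hr; apply: ltW.
have Sm : stuck m !=set0.
  have [s' hs'] := Shm; exists ((h^-1)%g s').
  by have := stuckJ (subgroupV sH Hh) hs'; rewrite tinvK.
have [[/andP[mS _] _] _] := stuck_supP m01 Sm.
have nR : H_right m n.
  split=> //; exists b => // y [|by_]; last by apply: nS; right.
  by case: (ltgtP y m) => // [/nm//|-> _].
have [y Sy ym] := inf_lt iS.1 mS.
by case/eqP: Sy; apply: rigid nR _ ym.
Qed.

Lemma H_right_moves x s : 0 < x -> x < s < 1 -> exists2 r, H_right x r & r s != s.
Proof.
move=> x0 xs1; apply: contrapT => no; apply: (not_stuck (s := s) x0); split=> // r xr.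
by apply/eqP; apply: contraT => rs; case: no; exists r.
Qed.

(** An element r of H supported to the right of u moves s.  Its support may extend
far beyond v, but an element k that fixes everything up to a point y between s and v
compresses it into (u, v) without changing what happens at s. *)
Lemma H_small_moves u s v : 0 < u -> u < s -> s < v -> v <= 1 ->
  exists2 n, H n & supp_in u v n /\ n s != s.
Proof.
move=> u0 us sv v1.
have [|r [Hr [b b1 rS]] rs] := @H_right_moves u s u0; first by apply/andP; split; lra.
pose y := (s + v) / 2.
have [z /andP[hz zb]|k [Hk [b' b'1 kS]] kb] :=
    @orbit_below _ _ (Num.max b y) ((y + v) / 2) (H_right_subgroup y).
  apply: H_right_moves; first by rewrite /y; lra.
  have : Num.max b y < 1 by rewrite gt_max b1 /y /=; lra.
  by move=> ?; rewrite /y in hz *; apply/andP; split; lra.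
have kid x : x <= y -> k x = x by move=> xy; apply: kS; left.
exists (r ^ k)%g; first exact: subgroupJ.
have kV x : x <= y -> (k^-1)%g x = x by move=> /kid/tfixV.
split; last first.
  rewrite tconjE kV; last by rewrite /y; lra.
  apply: contra rs => /eqP E; apply/eqP/(@tinj _ k); rewrite E kid //.
  by rewrite /y; lra.
apply: supp_in_sub (supp_inJ (g := k) rS); first by rewrite kid // /y; lra.
have : k b <= k (Num.max b y) by rewrite thompson_le le_max lexx.
by move=> ?; rewrite /y in kb; lra.
Qed.

(** * The elements of H that are the identity near 0 and 1 are normal in F *)

Section Normality.
Variable f : thompson R.

Let conj_in_H (c d : R) : Prop := forall n a b, H n -> c < a -> b < d -> supp_in a b n ->
  H (n ^ f)%g.

Lemma conj_in_H_sub c d c' d' : c <= c' -> d' <= d -> conj_in_H c d -> conj_in_H c' d'.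
Proof.
move=> cc dd gcd n a b Hn ca bd; apply: gcd => //; first exact: le_lt_trans cc ca.
exact: lt_le_trans bd dd.
Qed.

(** Near x conjugation by f is conjugation by an element of H. *)
Lemma conj_in_H_local x : 0 < x < 1 -> exists2 e, 0 < e & conj_in_H (x - e) (x + e).
Proof.
move=> x01; have [h Hh [e e0 fh]] := locally_H_everywhere f x01; exists e => // n a b Hn ca bd nS.
rewrite (conj_eq_on (g := h) nS); first exact: subgroupJ.
by move=> y /andP[ay yb]; apply: fh; apply/andP; split; lra.
Qed.

(** The elements whose conjugates by f stay in H form a group K.  Those supported
in (p, d) compress the support of n into (c, q), so a K-conjugate of n is in K, and
then n is. *)
Lemma conj_in_H_cat c p q d : 0 < c -> c < p -> p < q -> q < d -> d <= 1 ->
  conj_in_H c q -> conj_in_H p d -> conj_in_H c d.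
Proof.
move=> c0 cp pq qd d1 gcq gpd n a b Hn ca bd nS.
have [bq|qb] := ltP b q; first exact: gcq nS.
pose c2 := (c + Num.min a p) / 2; pose d2 := (b + d) / 2.
have [m1 m2] : Num.min a p <= a /\ Num.min a p <= p by rewrite !ge_min !lexx orbT.
have m3 : c < Num.min a p by rewrite lt_min ca.
pose K : set (thompson R) := [set g | [/\ H g, H (g ^ f)%g & supp_in c2 d2 g]].
have sK : subgroup K.
  apply: subgroupP.
  - by split; rewrite ?conj1g; [exact: subgroup1|exact: subgroup1|exact: supp_in1].
  - move=> g k [? ? ?] [? ? ?]; split; [exact: subgroupM| |exact: supp_inM].
    by rewrite conjMg; apply: subgroupM.
  - move=> g [? ? ?]; split; [exact: subgroupV| |exact: supp_inV].
    by rewrite conjVg; apply: subgroupV.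
have [z /andP[hz zb]|k [Hk Hkf kS] kb] := @orbit_below _ K b ((p + q) / 2) sK.
  have [||||g Hg [gS gz]] := @H_small_moves ((p + z) / 2) z d2; rewrite /d2; try lra.
  exists g => //; split=> //; last by apply: supp_in_sub gS; rewrite /c2 /d2; lra.
  by apply: gpd gS => //; rewrite /d2; lra.
have nkf : H ((n ^ k) ^ f)%g.
  apply: gcq (supp_inJ (g := k) nS); [exact: subgroupJ| |lra].
  have : k c2 < k a by rewrite thompson_lt /c2; lra.
  by rewrite kS ?lexx; [rewrite /c2; lra | left].
rewrite conjJg in nkf.
by rewrite -(conjgK (k ^ f)%g (n ^ f)%g); apply: subgroupJ => //; apply: subgroupV.
Qed.

(** By [conj_in_H_local] and [conj_in_H_cat] the supremum of the admissible right
ends is 1. *)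
Lemma conj_in_H_all c d : 0 < c -> d < 1 -> conj_in_H c d.
Proof.
move=> c0 d1.
have [dc|cd] := leP d c.
  move=> n a b Hn ca bd nS; have -> : n = 1%g; last by rewrite conj1g; apply: subgroup1.
  apply: thompson_eqP => x; apply: nS.
  by have [xa|ax] := leP x a; [left | right; lra].
pose S : set R := [set x | c < x < 1 /\ conj_in_H c x].
have [|e e0 ge] := @conj_in_H_local c; first by apply/andP; split; lra.
have Sc : S (Num.min (c + e) ((c + d) / 2)).
  split; last first.
    by apply: conj_in_H_sub ge; rewrite ?ge_min ?lexx //; lra.
  have : Num.min (c + e) ((c + d) / 2) <= (c + d) / 2 by rewrite ge_min lexx orbT.
  have : c < Num.min (c + e) ((c + d) / 2) by rewrite lt_min; apply/andP; split; lra.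
  by move=> ? ?; apply/andP; split; lra.
have supS : has_sup S by split; [eexists; exact: Sc | exists 1 => x [/andP[_ /ltW]]].
pose m := sup S.
have cm : c < m.
  apply: lt_le_trans (ub_le_sup supS.2 Sc).
  by case: Sc => /andP[].
have m1 : m <= 1 by apply: ge_sup => [|x [/andP[_ /ltW]]] //; eexists; exact: Sc.
have [mlt1|m1'] := ltP m 1; last first.
  have [x [_ gx] dx] : exists2 x, S x & d < x by apply: sup_gt; [eexists; exact: Sc|exact: lt_le_trans d1 m1'].
  exact: conj_in_H_sub (lexx c) (ltW dx) gx.
have [|e' e'0 ge'] := @conj_in_H_local m; first by apply/andP; split; lra.
have [x [/andP[cx x1] gx] mx] : exists2 x, S x & m - e' < x.
  by apply: sup_gt; [eexists; exact: Sc | rewrite -/m; lra].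
have xm : x <= m by apply: (ub_le_sup supS.2); split; rewrite ?cx.
pose e2 := Num.min e' ((1 - m) / 2).
have e20 : 0 < e2 by rewrite lt_min e'0; lra.
have [e21 e22] : e2 <= e' /\ e2 <= (1 - m) / 2 by rewrite !ge_min !lexx orbT.
pose p := Num.max (m - e') ((c + x) / 2).
have px : p < x by rewrite gt_max mx /=; lra.
have [p1 p2] : m - e' <= p /\ (c + x) / 2 <= p by rewrite !le_max !lexx orbT.
have : S (m + e2).
  split; first by apply/andP; split; lra.
  apply: (conj_in_H_cat (p := p) (q := x)) => //; try lra.
  by apply: conj_in_H_sub ge' => //; lra.
by move=> /(ub_le_sup supS.2); rewrite -/m; lra.
Qed.

End Normality.

Lemma H_compact_supp_normal n f : H_compact_supp n -> H_compact_supp (n ^ f)%g.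
Proof.
move=> [Hn cn]; split; last exact: compact_suppJ.
have [a a0 [b b1 nS]] := cn.
by apply: (@conj_in_H_all f (a / 2) ((b + 1) / 2)) nS => //; lra.
Qed.

(** * The commutator subgroup is contained in H *)

Local Notation N := H_compact_supp.

Let sN : subgroup N := H_compact_supp_subgroup.

Let N_conj f n : N n -> N (n ^ f)%g.
Proof. exact: H_compact_supp_normal. Qed.

Let N_commr f n : N n -> N [~ n, f]%g.
Proof. by move=> Nn; apply: (subgroupM sN); [apply: subgroupV | apply: N_conj]. Qed.

Let N_comml f n : N n -> N [~ f, n]%g.
Proof. by move=> Nn; rewrite -invgR; apply: (subgroupV sN); apply: N_commr. Qed.

(** Higman's argument: if n in N displaces the supports of f and g, then the
commutator of g with f^-1 is also that of g with [f, n], which is in N. *)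
Lemma compact_supp_commutator f g : compact_supp f -> compact_supp g -> N [~ f, g]%g.
Proof.
have step h k : compact_supp h -> compact_supp k -> N [~ k, h^-1]%g.
  move=> [a a0 [b b1 hS]] [a' a'0 [b' b'1 kS]].
  (* n will displace [c, d] *)
  pose c := Num.min a a'; pose d := Num.max b b'.
  have c0 : 0 < c by rewrite lt_min a0.
  have d1 : d < 1 by rewrite gt_max b1.
  have [m1 m2 m3 m4] : [/\ c <= a, c <= a', b <= d & b' <= d].
    by rewrite !ge_min !le_max !lexx !orbT.
  have [z /andP[cz zd]|n Nn dn] := @orbit_above _ N c d sN.
    apply: H_compact_supp_moves.
    by apply/andP; split; lra.
  have hS' : supp_in c d h by apply: supp_in_sub hS.
  have kS' : supp_in c d k by apply: supp_in_sub kS.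
  have hVS := supp_inV hS'.
  have khS : supp_in c d (k ^ h^-1)%g.
    have := supp_inJ (g := (h^-1)%g) kS'.
    by rewrite (hVS c) ?(hVS d) ?lexx //; [right | left].
  have comm := supp_in_commute khS (supp_inJ (g := n) hS') (ltW dn).
  have -> : [~ k, h^-1]%g = [~ k, [~ h, n]]%g; last exact/N_comml/N_comml.
  have conj_comm (x y : thompson R) : (x * y = y * x)%g -> (x ^ y)%g = x :> thompson R.
    by move=> xy; rewrite /conjg xy mulKg.
  rewrite -[LHS]/(k^-1 * k ^ h^-1)%g -[RHS]/(k^-1 * k ^ [~ h, n])%g; congr (_ * _)%g.
  by rewrite (_ : [~ h, n]%g = (h^-1 * h ^ n)%g) // conjgM; apply/esym/conj_comm.
by move=> cf cg; rewrite -[g]invgK; apply: step => //; apply: subgroupV => //;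
  apply: compact_supp_subgroup.
Qed.

(** On the support of c the map f may be replaced by an element that is the
identity near 0 and 1. *)
Lemma compact_supp_central c f : compact_supp c -> N [~ c, f]%g.
Proof.
move=> cc; have [a a0 [b b1 cS]] := cc.
have [e ce eE] := compact_extension f a0 b1.
have -> : [~ c, f]%g = [~ c, e]%g; last exact: compact_supp_commutator.
by congr (_ * _)%g; apply: conj_eq_on cS _ => y /eE.
Qed.

(** Modulo N the commutator of h * c and h' * c' is that of h and h', since c and
c' are central; and the commutator of h and h' is in H. *)
Lemma commutator_in_N f g : N [~ f, g]%g.
Proof.
have [h [c [Hh cc ->]]] := H_compact f.
have [h' [c' [Hh' cc' ->]]] := H_compact g.
rewrite commMgJ; apply: (subgroupM sN); last exact: compact_supp_central.
apply: N_conj; rewrite commgMJ; apply: (subgroupM sN).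
  by rewrite -invgR; apply: (subgroupV sN); apply: compact_supp_central.
apply: N_conj; split; first exact: subgroupR.
by apply: derived_compact_supp; apply: sub_gen_smallest; exists h => //; exists h'.
Qed.

Lemma piecewise_H_full : H = setT.
Proof.
apply/seteqP; split=> // f _.
have [h [c [Hh Dc ->]]] := H_derived f; apply: subgroupM => //.
have [//] : N c; move: c Dc; apply: smallest_sub => //.
by move=> _ [f' _ [g' _ <-]]; apply: commutator_in_N.
Qed.

End PiecewiseH.

Lemma piecewise_mul (R : realType) (H : set (thompson R)) (h c : thompson R) :
  subgroup H -> H h -> piecewise H c 0 1 -> piecewise H (h * c)%g 0 1.
Proof.
move=> sH Hh [s [ds sP]]; exists (map (h^-1)%g s); split.
  by move=> p /mapP[q /ds dq ->]; apply: thompson_dyadic_all.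
move=> x y x0 xy y1 nb.
have [||||k Hk kP] := sP (h x) (h y).
- by rewrite -(thompson0 (thompsonP h)) thompson_le.
- by rewrite thompson_lt.
- by rewrite -(thompson1 (thompsonP h)) thompson_le.
- by move=> p ps; rewrite -(tinvKV h p) !thompson_lt; apply: nb; apply: map_f.
exists (h * k)%g; first exact: subgroupM.
by move=> z /andP[xz zy]; rewrite !tmulE kP // !thompson_le xz.
Qed.

Theorem theorem1p3 (R : realType) (H : set (thompson R)) (S : set tree_diagram)
    (subgroupH : subgroup H)
    (reducedS : forall D, S D -> reduced D)
    (genH : generated [set f | exists2 D, S D & represents D f] = H) :
  H = setT <->
  set_mulg H (derived (thompson R)) = setT /\
  derived (thompson R) `<=` DG (core S) R.
Proof.
split=> [HT|[HD DC]].
  split; last by move=> f _; apply: generated_sub_DG; rewrite genH HT.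
  apply/seteqP; split=> // f _; exists f; first by rewrite HT.
  exists 1%g; last by rewrite mulg1.
  by move=> K [sK _]; apply: subgroup1.
have realS D : S D -> exists2 h, H h & represents D h.
  move=> SD; have [f fD] := diagram_represented R D; exists f => //.
  by rewrite -genH; apply: sub_gen_smallest; exists D.
have HD' (f : thompson R) : exists h c, [/\ H h, derived (thompson R) c & f = (h * c)%g].
  have [h Hh [c Dc <-]] : set_mulg H (derived (thompson R)) f by rewrite HD.
  by exists h, c.
apply: piecewise_H_full => // f; have [h [c [Hh /DC Dc ->]]] := HD' f.
by apply: piecewise_mul => //; apply: DG_core_piecewise realS _ Dc.
Qed.
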